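(* Let $(X_n)_{n\ge 0}$ be a Galton--Watson process with immigration such that $X_0$ and $\xi$ are regularly varying with index $\beta \in [1,\infty)$ (the same index for both), $\mathbb{P}(\xi > x) = \mathrm{O}(\mathbb{P}(X_0 > x))$ as $x \to \infty$, and there exists $r \in (\beta,\infty)$ such that $\mathbb{E}(\varepsilon^r) < \infty$. In case of $\beta = 1$, assume additionally that $\mathbb{E}(X_0) \in (0,\infty)$ and $m_\xi \in (0,\infty)$. Then for each $n \in \mathbb{N}$, we have $$\mathbb{P}(X_n > x) \sim \mathbb{E}(X_0)\, m_\xi^{n-1} \sum_{i=0}^{n-1} m_\xi^{i(\beta-1)}\, \mathbb{P}(\xi > x) + m_\xi^{n\beta}\, \mathbb{P}(X_0 > x) + m_\varepsilon \sum_{i=1}^{n-1} m_\xi^{n-i-1} \sum_{j=0}^{n-i-1} m_\xi^{j(\beta-1)}\, \mathbb{P}(\xi > x)$$ as $x \to \infty$, and hence $X_n$ is also regularly varying with index $\beta$.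
   Context: A Galton--Watson process with immigration is a stochastic process $(X_n)_{n\ge 0}$ given by $X_n = \sum_{i=1}^{X_{n-1}} \xi_{n,i} + \varepsilon_n$, $n \ge 1$, where $\{X_0, \xi_{n,i}, \varepsilon_n : n,i \ge 1\}$ are independent non-negative integer-valued random variables, the $\xi_{n,i}$ ($n,i\ge1$) are identically distributed, the $\varepsilon_n$ ($n\ge 1$) are identically distributed, and $\sum_{i=1}^0 := 0$. Here $\xi$ and $\varepsilon$ denote random variables with the distribution of $\xi_{1,1}$ and $\varepsilon_1$, respectively, and $m_\xi := \mathbb{E}(\xi) \in [0,\infty]$, $m_\varepsilon := \mathbb{E}(\varepsilon) \in [0,\infty]$. Empty sums are $0$; $\mathbb{N} = \{1,2,\ldots\}$. A non-negative random variable $X$ is regularly varying with index $\alpha \in [0,\infty)$ if $\mathbb{P}(X > x) > 0$ for all $x > 0$ and $\lim_{x\to\infty} \mathbb{P}(X > qx)/\mathbb{P}(X > x) = q^{-\alpha}$ for all $q > 0$. $f(x) \sim g(x)$ as $x\to\infty$ means $\lim_{x\to\infty} f(x)/g(x) = 1$, and $f(x) = \mathrm{O}(g(x))$ as $x\to\infty$ means $\limsup_{x\to\infty} f(x)/g(x) < \infty$. *)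

(* Defs.v *)
From HB Require Import structures.
From mathcomp Require Import all_boot all_order all_algebra.
From mathcomp Require Import all_classical all_reals all_analysis.
Import Order.TTheory GRing.Theory Num.Theory.
Import numFieldNormedType.Exports.

Set Implicit Arguments.
Unset Strict Implicit.
Unset Printing Implicit Defensive.

Local Open Scope classical_set_scope.
Local Open Scope ring_scope.

Section asymptotics.
Context {R : realType}.
Implicit Types f g : R -> R.

Definition asymp_equiv f g : Prop := f x / g x @[x --> +oo] --> (1 : R).

Definition asymp_bigO f g : Prop :=
  (limf_esup (fun x : R => (f x / g x)%:E) (pinfty_nbhs R) < +oo)%E.

End asymptotics.

Section random_variables.
Context {d : measure_display} {T : measurableType d} {R : realType}.
Variable P : probability T R.

Definition tail (X : {RV P >-> R}) (x : R) : R := fine (ccdf X x).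

Definition regularly_varying (X : {RV P >-> R}) (alpha : R) : Prop :=
  [/\ forall w, 0 <= X w,
      forall x, 0 < x -> 0 < tail X x
    & forall q, 0 < q ->
        tail X (q * x) / tail X x @[x --> +oo] --> q `^ (- alpha)].

Definition identically_distributed {d' : measure_display}
    {T' : measurableType d'} (X Y : {RV P >-> T'}) : Prop :=
  forall A, measurable A -> distribution P X A = distribution P Y A.

Definition mutually_independent {d' : measure_display}
    {T' : measurableType d'} {I : eqType} (Y : I -> {RV P >-> T'}) : Prop :=
  forall (s : seq I) (B : I -> set T'), uniq s ->
    (forall i, measurable (B i)) ->
    P (\bigcap_(i in [set` s]) (Y i @^-1` B i)) =
    (\prod_(i <- s) P (Y i @^-1` B i))%E.

Definition real_of_nat_rv (X : {RV P >-> nat}) : T -> R := fun w => (X w)%:R.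

Lemma measurable_real_of_nat_rv (X : {RV P >-> nat}) :
  measurable_fun [set: T] (real_of_nat_rv X).
Proof.
have mn : measurable_fun [set: nat] (fun k : nat => k%:R : R) by [].
exact: (measurableT_comp mn (measurable_funPT X)).
Qed.

HB.instance Definition _ (X : {RV P >-> nat}) :=
  isMeasurableFun.Build _ _ _ _ (real_of_nat_rv X)
    (measurable_real_of_nat_rv X).

Definition real_rv (X : {RV P >-> nat}) : {RV P >-> R} := real_of_nat_rv X.

End random_variables.

Section galton_watson.
Context {d : measure_display} {T : measurableType d} {R : realType}.
Variable P : probability T R.
Implicit Types (X eps : nat -> {RV P >-> nat})
  (xi : nat -> nat -> {RV P >-> nat}).

(* The family {X_0, xi_(n,i), eps_n : n, i >= 1}; the values of xi and eps at
   index 0 are never used. *)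
Definition gwi_family (X0 : {RV P >-> nat}) xi eps
    (k : unit + (nat * nat + nat)) : {RV P >-> nat} :=
  match k with
  | inl _ => X0
  | inr (inl (n, i)) => xi n.+1 i.+1
  | inr (inr n) => eps n.+1
  end.

Record gw_immigration X xi eps : Prop := GWImmigration {
  gwi_indep : mutually_independent (gwi_family (X 0%N) xi eps);
  gwi_xi_id : forall n i, (1 <= n)%N -> (1 <= i)%N ->
    identically_distributed (xi n i) (xi 1%N 1%N);
  gwi_eps_id : forall n, (1 <= n)%N ->
    identically_distributed (eps n) (eps 1%N);
  gwi_rec : forall n w, (1 <= n)%N ->
    X n w = (\sum_(1 <= i < (X n.-1 w).+1) xi n i w + eps n w)%N }.

End galton_watson.

(* Main.v *)
Require Import Defs.
From mathcomp Require Import all_boot all_order all_algebra.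
From mathcomp Require Import all_classical all_reals all_analysis.
From mathcomp Require Import measurable_realfun.
From mathcomp Require Import ring lra zify.
Import Order.TTheory GRing.Theory Num.Theory.
Import numFieldNormedType.Exports.

(** The law of X_n given X_(n-1) = k is that of xi_1 + ... + xi_k + eps, so the
theorem follows by iterating one statement about random sums: if N and the
summands xi are regularly varying with the same index beta >= 1, have finite
means a and m, and are independent, then
    P (xi_1 + ... + xi_N > x) ~ a P (xi > x) + m^beta P (N > x).
A sum of this kind is large either because one of its summands is, which
happens about a times as often as for a single summand, or because N exceeds
x / m. The proof ([random_sum_tail]) separates the values k of N, with
S_k = xi_1 + ... + xi_k.
 - For k <= K fixed, P (S_k > x) ~ k P (xi > x) ([conv_tail_fixed]).
 - For K < k <= q x / m with q < 1, P (S_k > x) <= C k P (xi > x) with C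
   independent of k and x ([conv_tail_uniform]); the total contribution is at
   most C E (N; N > K) P (xi > x), which is negligible for K large.
 - For k >= q x / m with q > 1, P (S_k > x) is close to 1 by the law of large
   numbers ([conv_cdf_lln]).
 - The remaining k, near x / m, matter little because P (N > q x / m) is
   asymptotic to q^(- beta) m^beta P (N > x), and q is arbitrarily close to 1.

The uniform bound is the heart of the matter. Truncating the summands at
y = h x costs k P (xi > y), and Chernoff's inequality handles the truncated sum.
With exponent s = L / y, where exp (- L) = k P (xi > y), the truncated moment
generating function is 1 + s m (1 + small) + O(1 / k) ([truncated_mgf_le]), so
the k-th power of it costs only a constant factor beyond exp (s m k), and the
probability is O(exp (- L)) as soon as h is small enough. Only a finite mean and
polynomial comparison of P (xi > x) at different scales
([rv_almost_increasing]) enter, which is why beta = 1 is no exception.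

Everything about S_k is derived from the recursion satisfied by its distribution
function [conv_cdf], a finite sum over the values of one summand. Measure theory
enters in showing that X_n is independent of everything that happens after time
n, which follows from the closure properties of [indep_of], and in computing
E X_(n+1) = m E X_n + E eps. The immigration has a tail O(x^(- r)) with
r > beta, and perturbs the sum negligibly ([asymp_equiv_light_perturbation]).
The coefficient c_n of P (xi > x) therefore satisfies
c_(n+1) = E X_n + m^beta c_n, which the closed form in the theorem solves
([gwi_xi_coefS]). *)

Set Implicit Arguments.
Unset Strict Implicit.
Unset Printing Implicit Defensive.

Local Open Scope classical_set_scope.
Local Open Scope ring_scope.

(** * Regularly varying functions *)

Section eventually.
Context {R : realType}.
Implicit Types (F f g : R -> R) (A : R -> Prop).

Lemma near_pinfty_ge A :
  (\forall x \near +oo, A x) <-> exists2 x0, 0 < x0 & forall x, x0 <= x -> A x.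
Proof.
split=> [[M [_ AM]]|[x0 x0_gt0 Ax0]].
  exists (Num.max M 0 + 1) => [|x]; first by rewrite ltr_wpDl// le_max lexx orbT.
  move=> hx; apply: AM; apply: lt_le_trans hx.
  by rewrite (le_lt_trans (y := Num.max M 0)) ?le_max ?lexx// ltrDl.
by exists x0; split => [|x /ltW]; [exact: num_real | exact: Ax0].
Qed.

Lemma near_pinfty_scale A c : 0 < c ->
  (\forall x \near +oo, A x) -> \forall x \near +oo, A (c * x).
Proof.
move=> c0 /near_pinfty_ge[x0 x0_gt0 Ax0]; apply/near_pinfty_ge.
exists (x0 / c) => [|x hx]; first exact: divr_gt0.
by apply: Ax0; rewrite -ler_pdivrMl// mulrC.
Qed.

Lemma asymp_equivP f g : (\forall x \near +oo, 0 < g x) ->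
  asymp_equiv f g <->
  forall e : R, 0 < e ->
    \forall x \near +oo, (1 - e) * g x <= f x <= (1 + e) * g x.
Proof.
move=> g0; split=> [fg e e0|fg].
  have h : \forall x \near +oo, `|1 - f x / g x| < e by move/cvgrPdist_lt: fg; exact.
  apply: (filterS2 _ _ g0 h) => x gx; rewrite ltr_norml => /andP[h1 h2].
  rewrite -(ler_pdivlMr _ _ gx) -(ler_pdivrMr _ _ gx).
  by apply/andP; split; lra.
rewrite /asymp_equiv; apply/cvgrPdist_le => e e0.
apply: (filterS2 _ _ g0 (fg _ e0)) => x gx.
rewrite -(ler_pdivlMr _ _ gx) -(ler_pdivrMr _ _ gx) => /andP[h1 h2].
by rewrite ler_norml; apply/andP; split; lra.
Qed.

End eventually.

Section regular_variation.
Context {R : realType}.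
Implicit Types (F G f g : R -> R) (alpha rho q : R).

(** Regular variation of a monotone function on the line, so that linear
combinations of tails are covered, which need not be tails themselves. *)
Definition rv_function F alpha : Prop :=
  [/\ {homo F : x y / x <= y >-> y <= x}, forall x, 0 < x -> 0 < F x
    & forall q, 0 < q -> F (q * x) / F x @[x --> +oo] --> q `^ (- alpha)].

Lemma rv_near_gt0 F alpha : rv_function F alpha -> \forall x \near +oo, 0 < F x.
Proof.
by case=> _ F0 _; apply: filterS (nbhs_pinfty_gt (num_real (0 : R))) => x; exact: F0.
Qed.

Lemma rv_le F alpha q c : rv_function F alpha -> 0 < q -> q `^ (- alpha) < c ->
  \forall x \near +oo, F (q * x) <= c * F x.
Proof.
move=> rF q0 qc; have F0 := rv_near_gt0 rF; case: rF => _ _ /(_ _ q0) Fq.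
apply: (filterS2 _ _ F0 (cvgr_lt _ Fq _ qc)) => x Fx.
by rewrite ltr_pdivrMr// => /ltW.
Qed.

Lemma rv_ge F alpha q c : rv_function F alpha -> 0 < q -> c < q `^ (- alpha) ->
  \forall x \near +oo, c * F x <= F (q * x).
Proof.
move=> rF q0 qc; have F0 := rv_near_gt0 rF; case: rF => _ _ /(_ _ q0) Fq.
apply: (filterS2 _ _ F0 (cvgr_gt _ Fq _ qc)) => x Fx.
by rewrite ltr_pdivlMr// => /ltW.
Qed.

(** A form of Potter's bounds. The ratio F (2 x) / F x converges to
2^(- alpha) > 2^(- rho), so x^rho F x at least does not decrease from x to 2 x
for x large; iterating along dyadic scales compares any two large arguments. *)
Lemma rv_almost_increasing F alpha rho : rv_function F alpha ->
  0 <= rho -> alpha < rho ->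
  exists2 x0, 0 < x0 & exists2 C, 0 < C &
    forall u y, x0 <= u -> u <= y -> u `^ rho * F u <= C * (y `^ rho * F y).
Proof.
move=> rF rho0 ar.
have two0 : (0 : R) < 2 by [].
have : 2 `^ (- rho) < 2 `^ (- alpha) :> R.
  by rewrite /powR gt_eqF// ltr_expR ltr_pM2r ?ltrN2// ln_gt0// ltr1n.
move=> /(rv_ge rF two0)/near_pinfty_ge[x0 x0_gt0 hx0].
have [dF F0 _] := rF.
have C0 : 0 < 2 `^ rho :> R by exact: powR_gt0.
have C1 : 1 <= 2 `^ rho :> R by rewrite -[leLHS](powRr0 2) ler_powR// ler1n.
exists x0 => //; exists (2 `^ rho) => // u y x0u uy.
have F2 v : x0 <= v -> F v <= 2 `^ rho * F (2 * v).
  by move=> /hx0; rewrite powRN mulrC ler_pdivrMr// mulrC.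
have [j] : exists j, y <= 2 ^+ j * u.
  have u0 : 0 < u by exact: lt_le_trans x0u.
  exists (Num.truncn (y / u)).+1; rewrite -ler_pdivrMr//.
  rewrite (le_trans (ltW (truncnS_gt _)))// -natrX ler_nat.
  exact: ltnW (ltn_expl _ _).
elim: j u x0u uy => [|j IH] u x0u uy.
  rewrite mul1r => yu; have -> : y = u by apply/eqP; rewrite eq_le yu.
  have u0 : 0 < u by exact: lt_le_trans x0u.
  by rewrite ler_peMl// mulr_ge0 ?powR_ge0// ltW// F0.
have u0 : 0 < u by exact: lt_le_trans x0u.
have [y2u _|] := lerP y (2 * u); last first.
  move=> u2y; rewrite exprSr -mulrA => hy.
  have x02u : x0 <= 2 * u by rewrite (le_trans x0u)// ler_peMl ?ltW// ltr1n.
  apply: le_trans (IH _ x02u (ltW u2y) hy).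
  by rewrite (powRM _ _ (ltW u0))// -mulrA mulrCA ler_wpM2l ?powR_ge0// F2.
have Fy : 0 < F y by apply: F0; exact: lt_le_trans uy.
have y0 : 0 < y by exact: lt_le_trans uy.
rewrite mulrCA; apply: ler_pM; [exact: powR_ge0|exact: ltW (F0 _ u0)| |].
  by apply: ge0_ler_powR => //; rewrite nnegrE ltW.
by rewrite (le_trans (F2 _ x0u))// ler_pM2l// dF.
Qed.

End regular_variation.

(** * Convolution powers of a mass function *)

Section convolution_powers.
Context {R : realType}.
Variable f : nat -> R.
Hypothesis f_ge0 : forall i, 0 <= f i.
Hypothesis f_le1 : forall n, \sum_(i < n) f i <= 1.

(** The tail of a mass function. The argument is real since regular variation
rescales it by real factors; truncation makes it constant on the negative
half-line, hence nonincreasing everywhere. *)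
Definition stail (x : R) : R := 1 - \sum_(i < (Num.truncn x).+1) f i.

Lemma stail_nat n : stail n%:R = 1 - \sum_(i < n.+1) f i.
Proof. by rewrite /stail natrK. Qed.

Lemma stail_truncn x : stail (Num.truncn x)%:R = stail x.
Proof. by rewrite stail_nat. Qed.

Lemma stail_ge0 x : 0 <= stail x.
Proof. by rewrite subr_ge0. Qed.

Lemma stail_le1 x : stail x <= 1.
Proof. by rewrite lerBlDr lerDl sumr_ge0. Qed.

Lemma psum_homo m n : (m <= n)%N -> \sum_(i < m) f i <= \sum_(i < n) f i.
Proof.
by move=> mn; rewrite (big_ord_widen _ f mn) big_mkcond /= ler_sum// => i _; case: ifP.
Qed.

Lemma stail_homo x y : x <= y -> stail y <= stail x.
Proof. by move=> xy; rewrite lerB// psum_homo// ltnS le_truncn. Qed.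

Lemma mass_le_stail (A : pred nat) N n : (forall i, A i -> (n < i)%N) ->
  \sum_(i < N | A i) f i <= stail n%:R.
Proof.
move=> An; rewrite stail_nat lerBrDl.
apply: le_trans (f_le1 (maxn N n.+1)).
rewrite (big_ord_widen _ f (leq_maxr N n.+1)).
rewrite (big_ord_widen_cond _ A f (leq_maxl N n.+1)).
set M := maxn N n.+1.
rewrite (@big_mkcond _ _ _ _ _ (fun i : 'I_M => A i && (i < N)%N)).
rewrite (@big_mkcond _ _ _ _ _ (fun i : 'I_M => i < n.+1)%N) -big_split/=.
apply: ler_sum => i _; have [/An ni|_] /= := boolP (A i).
  by rewrite ltnS leqNgt ni add0r; case: ifP.
by rewrite addr0; case: ifP.
Qed.

(** The probability that a sum of [k] independent variables with mass function
[f] is at most [n], computed by conditioning on one of the summands. *)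
Fixpoint conv_cdf (k n : nat) : R :=
  if k is k'.+1 then \sum_(i < n.+1) f i * conv_cdf k' (n - i) else 1.

Lemma conv_cdf_ge0 k n : 0 <= conv_cdf k n.
Proof. by elim: k n => [|k IH] n //=; apply: sumr_ge0 => i _; exact: mulr_ge0. Qed.

Lemma conv_cdf_homo k m n : (m <= n)%N -> conv_cdf k m <= conv_cdf k n.
Proof.
elim: k m n => [|k IH] m n mn //=.
rewrite (big_ord_widen _ (fun i => f i * conv_cdf k (m - i)) (_ : m.+1 <= n.+1)%N)//.
rewrite big_mkcond/= ler_sum// => i _; case: ifP => _.
  by rewrite ler_wpM2l// IH// leq_sub2r.
by rewrite mulr_ge0// conv_cdf_ge0.
Qed.

Lemma conv_cdf_le1 k n : conv_cdf k n <= 1.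
Proof.
elim: k n => [|k IH] n //=; apply: le_trans (f_le1 n.+1).
by apply: ler_sum => i _; rewrite ler_piMr.
Qed.

(** A sum that is at most [n] has all its summands at most [n]. *)
Lemma conv_cdfS_le k n : conv_cdf k.+1 n <= (1 - stail n%:R) * conv_cdf k n.
Proof.
rewrite stail_nat subKr mulr_suml; apply: ler_sum => i _.
by rewrite ler_wpM2l// conv_cdf_homo// leq_subr.
Qed.

Lemma conv_cdf_le k n : conv_cdf k n <= (1 - stail n%:R) ^+ k.
Proof.
elim: k n => [|k IH] n //=; rewrite exprS.
apply: le_trans (conv_cdfS_le k n) _.
by rewrite ler_wpM2l// subr_ge0 stail_le1.
Qed.

(* the conditional distribution function when the first summand is [i]; it
   vanishes when [i] alone exceeds [n] *)
Let conv_step k n i := if (i <= n)%N then conv_cdf k (n - i) else 0.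

(** The tail of the sum as an average over the first summand [i], with a range
that may reach beyond [n]: tail estimates can then be made pointwise in [i]. *)
Lemma conv_cdfS_widen k n N : (n < N)%N ->
  1 - conv_cdf k.+1 n =
  (1 - \sum_(i < N) f i) + \sum_(i < N) f i * (1 - conv_step k n i).
Proof.
move=> nN /=.
rewrite (big_ord_widen _ (fun i => f i * conv_cdf k (n - i)) nN) big_mkcond/=.
rewrite [X in _ = _ + X](eq_bigr (fun i : 'I_N => f i - f i * conv_step k n i));
  last by move=> i _; rewrite mulrBr mulr1.
rewrite sumrB addrA subrK; congr (_ - _); apply: eq_bigr => i _.
by rewrite /conv_step ltnS; case: ifP; rewrite ?mulr0.
Qed.

(** Either a summand exceeds [y], or Chernoff's inequality applies to the summands
truncated at [y]. In the induction, a first summand [i <= y] turns the bound for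
[n - i] into the bound for [n] multiplied by [expR (s * i)]; the condition
[1 <= phi] makes the bound at least 1 when [i > n]. *)
Lemma conv_tail_chernoff s phi y k n : 0 <= s -> 1 <= phi ->
  \sum_(i < y.+1) f i * expR (s * i%:R) <= phi ->
  1 - conv_cdf k n <= k%:R * stail y%:R + expR (- (s * n%:R)) * phi ^+ k.
Proof.
move=> s0 phi1 hphi; elim: k n => [|k IH] n.
  by rewrite mul0r add0r expr0 mulr1 subrr expR_ge0.
have phik : 1 <= phi ^+ k by exact: exprn_ege1.
set N := (maxn y n).+1.
rewrite (@conv_cdfS_widen _ _ N) ?ltnS ?leq_maxr//.
set E := expR (- (s * n%:R)).
have E0 : 0 < E by exact: expR_gt0.
have F0 := stail_ge0 y%:R.
pose b (i : nat) : R := if (i <= y)%N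
  then k%:R * stail y%:R + E * expR (s * i%:R) * phi ^+ k else 1.
have step i : 1 - conv_step k n i <= b i.
  rewrite /conv_step /b; case: (leqP i n) => [ilen|ltni]; last first.
    rewrite subr0; case: ifP => // _.
    rewrite ler_wpDl// ?mulr_ge0//; apply: mulr_ege1 => //.
    rewrite /E -expRD -[leLHS]expR0 ler_expR addrC subr_ge0.
    by rewrite ler_wpM2l// ler_nat ltnW.
  case: ifP => _; last by rewrite lerBlDr lerDl conv_cdf_ge0.
  by rewrite (le_trans (IH _))// lerD2l /E -expRD natrB// mulrBr opprB addrC.
apply: (@le_trans _ _ (1 - \sum_(i < N) f i + \sum_(i < N) f i * b i)).
  by rewrite lerD2l ler_sum// => i _; rewrite ler_wpM2l.
rewrite (bigID (fun i : 'I_N => (i < y.+1)%N))/=.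
rewrite [X in _ + X](bigID (fun i : 'I_N => (i < y.+1)%N))/=.
have yN : (y.+1 <= N)%N by rewrite ltnS leq_maxl.
rewrite -(big_ord_widen _ f yN) -(big_ord_widen _ (fun i => f i * b i) yN).
have -> : \sum_(i < N | ~~ (i < y.+1)%N) f i * b i = \sum_(i < N | ~~ (i < y.+1)%N) f i.
  by apply: eq_bigr => i; rewrite /b ltnS => /negbTE ->; rewrite mulr1.
have -> : \sum_(i < y.+1) f i * b i = k%:R * stail y%:R * \sum_(i < y.+1) f i
    + E * phi ^+ k * \sum_(i < y.+1) f i * expR (s * i%:R).
  rewrite !mulr_sumr -big_split/=; apply: eq_bigr => i _.
  by rewrite /b -ltnS ltn_ord; ring.
have h1 : k%:R * stail y%:R * \sum_(i < y.+1) f i <= k%:R * stail y%:R.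
  by rewrite ler_piMr// mulr_ge0.
have h2 : E * phi ^+ k * \sum_(i < y.+1) f i * expR (s * i%:R) <= E * phi ^+ k.+1.
  rewrite exprSr mulrA ler_wpM2l// mulr_ge0 ?(ltW E0)//.
  exact: le_trans phik.
have h3 := stail_nat y; have -> : k.+1%:R = k%:R + 1 :> R by rewrite natr1.
rewrite mulrDl mul1r; move: h1 h2 h3.
set a := \sum_(i < y.+1) f i; set c := \sum_(i < N | _) f i.
move: (stail _) (k%:R * _) (E * _) (E * _ * _) (k%:R * _ * a)  => t z w v u.
by move=> *; lra.
Qed.

(** Markov's inequality for [expR (- s * S_k)], [psi] being a bound for the Laplace
transform of one summand. *)
Lemma conv_cdf_chernoff s psi k n : 0 <= s ->
  (forall N, \sum_(i < N) f i * expR (- (s * i%:R)) <= psi) ->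
  conv_cdf k n <= expR (s * n%:R) * psi ^+ k.
Proof.
move=> s0 hpsi.
have psi0 : 0 <= psi by rewrite (le_trans _ (hpsi 0%N))// big_ord0.
elim: k n => [|k IH] n /=.
  by rewrite mulr1 -expR0 ler_expR mulr_ge0.
apply: (@le_trans _ _ (\sum_(i < n.+1)
    (f i * expR (- (s * i%:R))) * (expR (s * n%:R) * psi ^+ k))).
  apply: ler_sum => i _; rewrite -mulrA ler_wpM2l// (le_trans (IH _))//.
  have ilen : (i <= n)%N by rewrite -ltnS.
  by rewrite mulrA -expRD (natrB _ ilen) mulrBr addrC.
rewrite -mulr_suml exprS [leRHS]mulrCA ler_wpM2r//.
by rewrite mulr_ge0 ?expR_ge0 ?exprn_ge0.
Qed.

(** If the sum exceeds [n >= j + l], then the first summand exceeds [l], or the sum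
of the others exceeds [l], or both exceed [j]. The last event is of smaller
order, so that one large summand is the typical cause. *)
Lemma conv_tail_two_jumps k n j l : (j + l <= n)%N ->
  1 - conv_cdf k.+1 n <=
  stail l%:R + (1 - conv_cdf k l) + stail j%:R * (1 - conv_cdf k j).
Proof.
move=> jln; rewrite (@conv_cdfS_widen _ _ n.+1)//.
have H1 m : 0 <= 1 - conv_cdf k m by rewrite subr_ge0 conv_cdf_le1.
pose b (i : nat) : R := (if (l < i)%N then 1 else 0) + (1 - conv_cdf k l)
  + (if (j < i)%N then 1 - conv_cdf k j else 0).
have step i : (i < n.+1)%N -> 1 - conv_step k n i <= b i.
  rewrite ltnS /conv_step /b => ilen; rewrite ilen.
  have [_|il] := ltnP l i.
    rewrite -addrA ler_wpDr//; last by rewrite gerBl conv_cdf_ge0.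
    by rewrite addr_ge0//; case: ifP.
  have [_|ij] := ltnP j i.
    rewrite add0r ler_wpDl// lerB// conv_cdf_homo//; lia.
  rewrite add0r addr0 lerB// conv_cdf_homo//; lia.
apply: (@le_trans _ _ (1 - \sum_(i < n.+1) f i + \sum_(i < n.+1) f i * b i)).
  by rewrite lerD2l ler_sum// => i _; rewrite ler_wpM2l// step.
have -> : \sum_(i < n.+1) f i * b i = \sum_(i < n.+1 | (l < i)%N) f i
  + (1 - conv_cdf k l) * (\sum_(i < n.+1) f i)
  + (1 - conv_cdf k j) * \sum_(i < n.+1 | (j < i)%N) f i.
  rewrite !mulr_sumr (big_mkcond (fun i : 'I_n.+1 => l < i)%N)/=.
  rewrite (big_mkcond (fun i : 'I_n.+1 => j < i)%N)/= -!big_split/=.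
  by apply: eq_bigr => i _; rewrite /b; do 2 case: ifP => _; ring.
have h2 : (1 - conv_cdf k l) * (\sum_(i < n.+1) f i) <= 1 - conv_cdf k l.
  by rewrite ler_piMr.
have h3 : (1 - conv_cdf k j) * \sum_(i < n.+1 | (j < i)%N) f i
    <= stail j%:R * (1 - conv_cdf k j).
  by rewrite mulrC ler_wpM2r// (@mass_le_stail (fun i => j < i)%N).
have h1 : 1 - \sum_(i < n.+1) f i + \sum_(i < n.+1 | (l < i)%N) f i <= stail l%:R.
  rewrite stail_nat (bigID (fun i : 'I_n.+1 => (i < l.+1)%N))/=.
  have ln : (l.+1 <= n.+1)%N by lia.
  rewrite -(big_ord_widen _ f ln) opprD addrA.
  under [X in _ + X]eq_bigl => i do rewrite ltnNge -ltnS.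
  by rewrite subrK.
lra.
Qed.

End convolution_powers.

(** * The uniform large deviation bound *)

Section large_deviations.
Context {R : realType}.
Variable f : nat -> R.
Hypothesis f_ge0 : forall i, 0 <= f i.
Hypothesis f_le1 : forall n, \sum_(i < n) f i <= 1.
Local Notation F := (stail f).

(** This is [t <= expR t] at [t = c * x / rho], raised to the power [rho]. *)
Lemma powR_le_expR (rho c x : R) : 0 < rho -> 0 < c -> 0 <= x ->
  x `^ rho <= (rho / c) `^ rho * expR (c * x).
Proof.
move=> rho0 c0 x0.
have -> : x = (rho / c) * (c * x / rho) by field; rewrite !gt_eqF.
rewrite powRM ?divr_ge0 ?mulr_ge0 ?(ltW rho0) ?(ltW c0)//.
rewrite ler_wpM2l ?powR_ge0//.
have -> : c * (rho / c * (c * x / rho)) = (c * x / rho) * rho.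
  by field; rewrite !gt_eqF.
rewrite expRM; apply: ge0_ler_powR; rewrite ?nnegrE ?expR_ge0 ?(ltW rho0)//.
  by rewrite divr_ge0 ?mulr_ge0 ?(ltW rho0) ?(ltW c0).
by rewrite (le_trans _ (expR_ge1Dx _))// lerDr.
Qed.

Lemma rv_ge_expR (G : R -> R) alpha c : rv_function G alpha -> 0 <= alpha ->
  0 < c -> \forall x \near +oo, expR (- (c * x)) <= G x.
Proof.
move=> rG alpha0 c0; have [_ G0 _] := rG.
pose rho := alpha + 1.
have rho0 : 0 < rho by rewrite ltr_wpDl.
have [|x0 x00 [C C0 hC]] := rv_almost_increasing rG (ltW rho0); first by rewrite ltrDl.
set K := C * (rho / (c / 2)) `^ rho.
have c20 : 0 < c / 2 by rewrite divr_gt0.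
have K0 : 0 < K by rewrite mulr_gt0// powR_gt0// divr_gt0.
set D := x0 `^ rho * G x0.
have D0 : 0 < D by rewrite mulr_gt0 ?powR_gt0// G0.
near=> x.
have x0x : x0 <= x by near: x; exact: (nbhs_pinfty_ge (num_real _)).
have xx : 0 <= x by rewrite (le_trans _ x0x)// ltW.
have Gx : 0 < G x by apply: G0; exact: lt_le_trans x0x.
have h1 : D <= K * expR (c / 2 * x) * G x.
  apply: le_trans (hC _ _ (lexx _) x0x) _.
  rewrite /K -[C * _ * _]mulrA -[C * _ * G x]mulrA ler_pM2l//.
  by rewrite ler_pM2r// powR_le_expR.
have h2 : K / D <= expR (c / 2 * x).
  have : ln (K / D) / (c / 2) <= x by near: x; exact: (nbhs_pinfty_ge (num_real _)).
  by rewrite ler_pdivrMr// [leRHS]mulrC -ler_expR lnK ?posrE ?divr_gt0.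
rewrite expRN -div1r ler_pdivrMr ?expR_gt0//.
have -> : c * x = c / 2 * x + c / 2 * x by field.
rewrite expRD mulrA.
have h3 : K <= D * expR (c / 2 * x) by move: h2; rewrite ler_pdivrMr// mulrC.
rewrite -(ler_pM2l D0) mulr1 (le_trans h1)//.
rewrite [leRHS](_ : _ = D * expR (c / 2 * x) * (expR (c / 2 * x) * G x)); last by ring.
by rewrite -mulrA ler_wpM2r// mulr_ge0 ?expR_ge0 ?ltW.
Unshelve. all: by end_near. Qed.

(** Put s = L / y and split the values [i <= y] into three ranges.
 - For s i <= eta, exp (s i) <= 1 + s i exp eta, and the mean appears.
 - For y / 2 < i, exp (s i) <= exp L while the mass is at most F (y / 2), which
   is comparable to F y.
 - In between, exp (s i) <= exp (L / 2) while the mass is at most F (eta / s),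
   hence at most of order L^rho F y; the factor exp (- L / 2) gained over
   F y exp L absorbs the power of L.
The condition on [L] keeps eta / s in the range where F is compared
polynomially, since F y is not exponentially small. *)
Lemma truncated_mgf_le alpha m eta : rv_function F alpha -> 0 <= alpha ->
  (forall N, \sum_(i < N) i%:R * f i <= m) -> 0 < eta ->
  exists2 A, 0 < A & \forall y \near +oo, forall L, 0 <= L -> F y * expR L <= 1 ->
    \sum_(i < (Num.truncn y).+1) f i * expR (L / y * i%:R) <=
    1 + L / y * m * expR eta + A * (F y * expR L).
Proof.
move=> rF alpha0 fm eta0; have [dF F0 _] := rF.
pose rho := alpha + 1.
have rho0 : 0 < rho by rewrite ltr_wpDl.
have [|x0 x00 [C C0 hC]] := rv_almost_increasing rF (ltW rho0); first by rewrite ltrDl.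
pose B := (rho / (2^-1)) `^ rho.
have B0 : 0 < B by rewrite powR_gt0// divr_gt0.
pose A1 := C * (eta^-1 `^ rho) * B + 1.
have A10 : 0 < A1 by rewrite ltr_wpDl// !mulr_ge0// ?powR_ge0// ltW.
pose A2 : R := 2^-1 `^ (- alpha) + 1.
have A20 : 0 < A2 by rewrite ltr_wpDl// powR_ge0.
exists (A1 + A2); first exact: addr_gt0.
near=> y => L L0 FL.
have y0 : 0 < y by near: y; exact: (nbhs_pinfty_gt (num_real _)).
have Fy : 0 < F y by exact: F0.
set s := L / y.
have s0 : 0 <= s by rewrite divr_ge0// ltW.
have sy : s * y = L by rewrite /s divfK// gt_eqF.
clearbody s.
have mgf_pt (i : nat) : i%:R <= y -> expR (s * i%:R) <=
    1 + s * expR eta * i%:R + (if eta < s * i%:R then expR (L / 2) else 0)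
    + (if y / 2 < i%:R then expR L else 0).
  move=> iy; have si0 : 0 <= s * i%:R by rewrite mulr_ge0.
  have c1 : 0 <= 1 + s * expR eta * i%:R.
    by rewrite addr_ge0// !mulr_ge0 ?expR_ge0.
  have [yi|yi] := ltP (y / 2) i%:R.
    rewrite ler_wpDl//; first by rewrite addr_ge0//; case: ifP; rewrite ?expR_ge0.
    by rewrite ler_expR -sy ler_wpM2l.
  rewrite addr0; have [esi|esi] := ltP eta (s * i%:R).
    rewrite ler_wpDl// ler_expR -sy -mulrA ler_wpM2l//.
  rewrite addr0.
  have h1 : 1 - s * i%:R <= expR (- (s * i%:R)) by exact: expR_ge1Dx.
  have h2 : expR (s * i%:R) * (1 - s * i%:R) <= 1.
    by rewrite -[leRHS](expRxMexpNx_1 (s * i%:R)) ler_wpM2l// expR_ge0.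
  have h3 : expR (s * i%:R) * (s * i%:R) <= expR eta * (s * i%:R).
    by rewrite ler_wpM2r// ler_expR.
  rewrite mulrAC [_ * expR eta]mulrC; move: h2 h3; rewrite mulrBr mulr1.
  move: (_ * _) (expR eta * _) => a b; lra.
have tail_half : F (y / 2) <= A2 * F y.
  rewrite (mulrC y); near: y; apply: (rv_le rF) => //.
  by rewrite ltrDl.
have tail_mid : 0 < s -> F (eta / s) * expR (L / 2) <= A1 * (F y * expR L).
  move=> sp; have Lp : 0 < L by rewrite -sy mulr_gt0.
  have eL : expR L = expR (L / 2) * expR (L / 2) by rewrite -expRD -splitr.
  have e1 : 1 <= expR (L / 2) by rewrite -[leLHS]expR0 ler_expR divr_ge0.
  have u0 : 0 < eta / s by rewrite divr_gt0.
  have [uy|yu] := leP (eta / s) y; last first.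
    apply: (@le_trans _ _ (F y * expR L)); last first.
      rewrite ler_peMl ?mulr_ge0 ?(ltW Fy) ?expR_ge0// lerDr.
      by rewrite !mulr_ge0 ?powR_ge0 ?(ltW C0) ?(ltW B0).
    apply: ler_pM; rewrite ?expR_ge0 ?stail_ge0//; first exact: dF (ltW yu).
    by rewrite ler_expR ler_pdivrMr// ler_peMr// ler1n.
  (* [L <= - ln (F y)] is eventually below any multiple of [y] *)
  have x0u : x0 <= eta / s.
    have : expR (- (eta / x0 * y)) <= F y.
      by near: y; apply: (rv_ge_expR rF) => //; exact: divr_gt0.
    have : F y <= expR (- L) by rewrite expRN -div1r ler_pdivlMr ?expR_gt0.
    move=> /[swap] /le_trans /[apply]; rewrite ler_expR lerN2 -sy ler_pM2r//.
    by rewrite ler_pdivlMr// mulrC -ler_pdivlMr.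
  have := hC _ _ x0u uy.
  have -> : y `^ rho = (eta / s) `^ rho * (L * eta^-1) `^ rho.
    rewrite -powRM ?(ltW u0) ?mulr_ge0 ?invr_ge0 ?(ltW eta0)//; congr (_ `^ _).
    by rewrite -sy; field; rewrite !gt_eqF.
  rewrite mulrCA -!mulrA ler_pM2l ?powR_gt0// => h.
  have hL : L `^ rho <= B * expR (L / 2).
    by rewrite [L / 2]mulrC powR_le_expR.
  rewrite eL [leRHS]mulrA [leRHS]mulrA ler_wpM2r ?expR_ge0//.
  apply: (le_trans h); rewrite powRM ?invr_ge0 ?(ltW eta0)//.
  apply: (@le_trans _ _ (C * (B * expR (L / 2) * eta^-1 `^ rho * F y))).
    by rewrite mulrCA ler_pM2l// ler_pM2r// ler_wpM2r// powR_ge0.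
  rewrite /A1 mulrDl mul1r mulrDl ler_wpDr//.
    by rewrite mulr_ge0 ?(ltW Fy) ?expR_ge0.
  by rewrite le_eqVlt; apply/orP; left; apply/eqP; ring.
pose M := (Num.truncn y).+1.
have sum_split : \sum_(i < M) f i * expR (s * i%:R) <=
    \sum_(i < M) f i + s * expR eta * \sum_(i < M) i%:R * f i
    + expR (L / 2) * \sum_(i < M | eta < s * i%:R) f i
    + expR L * \sum_(i < M | y / 2 < i%:R) f i.
  rewrite !mulr_sumr (big_mkcond (fun i : 'I_M => eta < _))/=.
  rewrite (big_mkcond (fun i : 'I_M => _ < i%:R))/= -!big_split/=.
  apply: ler_sum => i _.
  apply: (@le_trans _ _ (f i * (1 + s * expR eta * i%:R
      + (if eta < s * i%:R then expR (L / 2) else 0)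
      + (if y / 2 < i%:R then expR L else 0)))).
    rewrite ler_wpM2l//; apply: mgf_pt.
    by rewrite -truncn_ge_nat ?(ltW y0)// -ltnS ltn_ord.
  rewrite le_eqVlt; apply/orP; left; apply/eqP.
  by do 2 case: ifP => _; ring.
apply: (le_trans sum_split).
have m1 : expR L * \sum_(i < M | y / 2 < i%:R) f i <= A2 * (F y * expR L).
  rewrite mulrC mulrA ler_wpM2r ?expR_ge0// (le_trans _ tail_half)//.
  rewrite -(stail_truncn f (y / 2)).
  apply: (mass_le_stail f_ge0 f_le1 (A := fun i : nat => y / 2 < i%:R)) => i yi.
  by rewrite truncn_lt_nat// divr_ge0// ltW.
have m2 : expR (L / 2) * \sum_(i < M | eta < s * i%:R) f i <= A1 * (F y * expR L).
  have [sp|] := ltP 0 s; last first.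
    move=> s_le0; have -> : s = 0 by apply/eqP; rewrite eq_le s_le0 s0.
    rewrite big1 ?mulr0 ?mulr_ge0 ?(ltW A10) ?(ltW Fy) ?expR_ge0//.
    by move=> i; rewrite mul0r ltNge (ltW eta0).
  rewrite mulrC (le_trans _ (tail_mid sp))// ler_wpM2r ?expR_ge0//.
  rewrite -(stail_truncn f (eta / s)).
  apply: (mass_le_stail f_ge0 f_le1 (A := fun i : nat => eta < s * i%:R)) => i ei.
  by rewrite truncn_lt_nat ?divr_ge0 ?(ltW eta0)// ltr_pdivrMr// mulrC.
have m3 : s * expR eta * \sum_(i < M) i%:R * f i <= s * m * expR eta.
  by rewrite [leRHS]mulrAC ler_wpM2l// mulr_ge0// expR_ge0.
have := f_le1 M; rewrite [(A1 + A2) * _]mulrDl.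
move: m1 m2 m3; rewrite -/M.
move: (expR L * _) (expR (L / 2) * _) (s * m * _) (s * _ * _).
move: (A1 * _) (A2 * _) (\sum_(i < M) f i).
move=> *; lra.
Unshelve. all: by end_near. Qed.

(** With y = h x and exp (- L) = k F y, the term [A * (F y * expR L)] of
[truncated_mgf_le] equals A / k, so its effect on the k-th power is bounded by
exp A. What remains is exp (- s x + s k m exp eta) <= exp (- s x (1 - q exp eta)),
and s x = L / h. For exp eta = (1 + q) / (2 q) the choice h = 1 - q exp eta
= (1 - q) / 2 turns this into exp (- L) = k F y. *)
Lemma conv_tail_uniform_nat alpha m q : rv_function F alpha -> 0 <= alpha ->
  (forall N, \sum_(i < N) i%:R * f i <= m) -> 0 < m -> 0 < q -> q < 1 ->
  exists2 C, 0 < C & \forall x \near +oo, forall n k : nat,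
    x = n%:R -> k%:R * m <= q * x -> 1 - conv_cdf f k n <= C * k%:R * F x.
Proof.
move=> rF alpha0 fm m0 q0 q1; have [dF F0 _] := rF.
pose E := (1 + q) / (2 * q); pose eta := ln E.
have E1 : 1 < E by rewrite /E ltr_pdivlMr ?mulr_gt0//; lra.
have E0 : 0 < E := lt_trans ltr01 E1.
have eta0 : 0 < eta by rewrite ln_gt0.
have expeta : expR eta = E by rewrite lnK// posrE.
have [A A0 hA] := truncated_mgf_le rF alpha0 fm eta0.
pose h := (1 - q) / 2.
have h0 : 0 < h by rewrite divr_gt0// subr_gt0.
have h1 : h < 1 by rewrite /h ltr_pdivrMr//; lra.
pose C1 : R := h `^ (- alpha) + 1.
have C10 : 0 < C1 by rewrite ltr_wpDl// powR_ge0.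
exists (C1 * (1 + expR A)); first by rewrite mulr_gt0// ltr_wpDr ?expR_ge0.
near=> x => n k xn kx.
have x0 : 0 < x by near: x; exact: (nbhs_pinfty_gt (num_real _)).
have y0 : 0 < h * x by exact: mulr_gt0.
have hAx : forall L, 0 <= L -> F (h * x) * expR L <= 1 ->
    \sum_(i < (Num.truncn (h * x)).+1) f i * expR (L / (h * x) * i%:R) <=
    1 + L / (h * x) * m * expR eta + A * (F (h * x) * expR L).
  by near: x; exact: (near_pinfty_scale h0 hA).
have Fh : F (h * x) <= C1 * F x.
  by near: x; apply: (rv_le rF) => //; rewrite ltrDl.
set y := h * x in y0 hAx Fh.
have Fx : 0 < F x by exact: F0.
have Fy : 0 < F y by exact: F0.
case: k kx => [|k] kx; first by rewrite subrr mulr0 mul0r.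
have k0 : 0 < k.+1%:R :> R by rewrite ltr0n.
suff H : 1 - conv_cdf f k.+1 n <= k.+1%:R * F y * (1 + expR A).
  apply: (le_trans H).
  rewrite [leRHS](_ : _ = k.+1%:R * (C1 * F x) * (1 + expR A)); last by ring.
  by rewrite ler_pM2r ?ltr_wpDr ?expR_ge0// ler_pM2l.
(* [L] must be nonnegative; otherwise the bound exceeds 1 *)
have [kF|kF] := ltP 1 (k.+1%:R * F y).
  rewrite (@le_trans _ _ 1)//; first by rewrite gerBl conv_cdf_ge0.
  by rewrite mulr_ege1// ?(ltW kF)// lerDl expR_ge0.
pose L := - ln (k.+1%:R * F y).
have kF0 : 0 < k.+1%:R * F y by exact: mulr_gt0.
have L0 : 0 <= L by rewrite oppr_ge0 ln_le0.
have eL : expR (- L) = k.+1%:R * F y by rewrite opprK lnK.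
have FL : F y * expR L = k.+1%:R^-1.
  by rewrite -[L]opprK expRN eL invfM mulrCA divff ?mulr1// gt_eqF.
have {hAx} := hAx L L0; rewrite FL invf_le1// ler1n => /(_ isT) hAx.
set s := L / y in hAx.
have sy : s * y = L by rewrite /s divfK// gt_eqF.
have s0 : 0 <= s by rewrite divr_ge0// ltW.
clearbody s.
pose phi := expR (s * m * E + A / k.+1%:R).
have phi1 : 1 <= phi.
  rewrite -[leLHS]expR0 ler_expR addr_ge0 ?divr_ge0 ?(ltW A0)//.
  by apply: mulr_ge0 (ltW E0); exact: mulr_ge0 s0 (ltW m0).
have := @conv_tail_chernoff _ _ f_ge0 f_le1 s phi (Num.truncn y) k.+1 n s0 phi1.
rewrite stail_truncn => H.
have {}H := H (le_trans hAx _).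
have {}H : 1 - conv_cdf f k.+1 n <=
    k.+1%:R * F y + expR (- (s * n%:R)) * phi ^+ k.+1.
  by apply: H; rewrite expeta -addrA expR_ge1Dx.
apply: (le_trans H); rewrite [leRHS]mulrDr [_ * 1]mulr1 lerD2l.
rewrite /phi -expRM_natl -eL -!expRD ler_expR.
have -> : k.+1%:R * (s * m * E + A / k.+1%:R) = k.+1%:R * m * (s * E) + A.
  by field; rewrite gt_eqF.
rewrite -xn -sy /y addrA lerD2r.
have : k.+1%:R * m * (s * E) <= q * x * (s * E).
  by rewrite ler_wpM2r//; exact: mulr_ge0 s0 (ltW E0).
have -> : q * x * (s * E) = s * x * ((1 + q) / 2).
  by rewrite /E; field; rewrite gt_eqF.
rewrite /h; lra.
Unshelve. all: by end_near. Qed.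

Lemma conv_tail_uniform alpha m q : rv_function F alpha -> 0 <= alpha ->
  (forall N, \sum_(i < N) i%:R * f i <= m) -> 0 < m -> 0 < q -> q < 1 ->
  exists2 C, 0 < C & \forall x \near +oo, forall k : nat,
    k%:R * m <= q * x -> 1 - conv_cdf f k (Num.truncn x) <= C * k%:R * F x.
Proof.
move=> rF alpha0 fm m0 q0 q1.
pose q' := (1 + q) / 2.
have q'0 : 0 < q' by rewrite /q'; lra.
have q'1 : q' < 1 by rewrite /q'; lra.
have [C C0 /near_pinfty_ge[x0 x00 hC]] := conv_tail_uniform_nat rF alpha0 fm m0 q'0 q'1.
exists C => //; near=> x => k kx; rewrite -(stail_truncn f x).
have x1 : x0 + 1 <= x by near: x; exact: (nbhs_pinfty_ge (num_real _)).
have x2 : (1 + q) / (1 - q) <= x by near: x; exact: (nbhs_pinfty_ge (num_real _)).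
have xn := truncnS_gt x; rewrite -natr1 in xn.
apply: hC => //; first by lra.
apply: (le_trans kx).
apply: (@le_trans _ _ (q' * (x - 1))); last by rewrite ler_pM2l//; lra.
rewrite ler_pdivrMr in x2; last by lra.
by rewrite /q'; lra.
Unshelve. all: by end_near. Qed.

End large_deviations.

(** * Fixed numbers of summands and the law of large numbers *)

Section random_sums.
Context {R : realType}.

(** Regular variation turns a small rescaling of the argument into a small
multiplicative error. *)
Lemma powRN_near1_lt (alpha e : R) : 0 <= alpha -> 0 < e ->
  exists2 q : R, 0 < q < 1 & q `^ (- alpha) < 1 + e.
Proof.
move=> alpha0 e0.
have a1 : 0 < alpha + 1 by rewrite ltr_wpDl.
have e2 : 1 < 1 + e / 2 by rewrite ltrDl divr_gt0.
have e20 : 0 < 1 + e / 2 := lt_trans ltr01 e2.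
exists ((1 + e / 2) `^ (- (alpha + 1)^-1)).
  rewrite powR_gt0//= powRN invf_lt1 ?powR_gt0// -[ltLHS](powRr0 (1 + e / 2)).
  by rewrite /powR gt_eqF// ltr_expR ltr_pM2r ?invr_gt0// ln_gt0.
rewrite -powRrM mulNr mulrN opprK.
apply: (@le_lt_trans _ _ (1 + e / 2)); last by lra.
rewrite -[leRHS]powRr1 ?(ltW e20)// ler_powR ?(ltW e2)//.
by rewrite mulrC ler_pdivrMr// mul1r lerDl.
Qed.

Lemma powRN_near1_gt (alpha e : R) : 0 <= alpha -> 0 < e ->
  exists2 q : R, 1 < q & 1 - e < q `^ (- alpha).
Proof.
move=> alpha0 e0; have [q /andP[q0 q1] qe] := powRN_near1_lt alpha0 e0.
exists q^-1; first by rewrite invf_gt1.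
have Q0 : 0 < q `^ (- alpha) by exact: powR_gt0.
rewrite -(powR_inv1 (ltW q0)) -powRrM mulrNN mul1r -[alpha]opprK powRN.
apply: (@lt_trans _ _ (1 + e)^-1).
  rewrite -div1r ltr_pdivlMr ?addr_gt0//; nra.
by rewrite ltf_pV2 ?posrE// addr_gt0.
Qed.

Lemma expr_1B_le (u : R) k : 0 <= u <= 1 ->
  (1 - u) ^+ k <= 1 - k%:R * u + (k%:R * u) ^+ 2.
Proof.
case/andP => u0 u1; elim: k => [|k IH]; first by rewrite expr0 mul0r expr0n subr0 addr0.
rewrite exprS.
apply: (@le_trans _ _ ((1 - u) * (1 - k%:R * u + (k%:R * u) ^+ 2))).
  by rewrite ler_wpM2l// subr_ge0.
rewrite -natr1; have : 0 <= k%:R :> R by [].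
move: (k%:R) => c c0.
rewrite -subr_ge0 [leRHS](_ : _ = (c + 1) * u ^+ 2 + c ^+ 2 * u ^+ 3); last by ring.
by rewrite addr_ge0// mulr_ge0 ?exprn_ge0// addr_ge0.
Qed.

Section one_law.
Variable f : nat -> R.
Hypothesis f_ge0 : forall i, 0 <= f i.
Hypothesis f_le1 : forall n, \sum_(i < n) f i <= 1.
Local Notation F := (stail f).

Definition is_mean (m : R) := \sum_(i < N) i%:R * f i @[N --> \oo] --> m.

Lemma is_mean_le m : is_mean m -> forall N, \sum_(i < N) i%:R * f i <= m.
Proof.
move=> fm N; rewrite -(cvg_lim _ fm)//; apply: (@nondecreasing_cvgn_le _ (fun N => _)).
  move=> a b ab; rewrite (big_ord_widen _ (fun i => i%:R * f i) ab) big_mkcond /=.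
  by apply: ler_sum => i _; case: ifP => // _; exact: mulr_ge0.
by apply/cvg_ex; exists m.
Qed.

Lemma is_mean_ge m e : is_mean m -> 0 < e ->
  \forall N \near \oo, m - e < \sum_(i < N) i%:R * f i.
Proof. by move=> fm e0; apply: (cvgr_gt _ fm); rewrite ltrBlDr ltrDl. Qed.

(** The principle of a single big jump. The upper bound is by induction on [k] with
[conv_tail_two_jumps] at the levels (1 - q) x and q x, for q close to 1; the lower
bound is P (max of the summands > x) = 1 - (1 - F x)^k. *)
Lemma conv_tail_fixed alpha k e : rv_function F alpha -> 0 <= alpha ->
  F x @[x --> +oo] --> 0 -> 0 < e ->
  \forall x \near +oo, (k%:R - e) * F x <= 1 - conv_cdf f k (Num.truncn x)
    <= (k%:R + e) * F x.
Proof.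
move=> rF alpha0 F0 e0.
have Fsmall c d : 0 < c -> 0 < d -> \forall x \near +oo, F (d * x) < c.
  move=> c0 d0; apply: (near_pinfty_scale (A := fun x => F x < c) d0).
  exact: (cvgr_lt _ F0).
suff low : \forall x \near +oo, (k%:R - e) * F x <= 1 - conv_cdf f k (Num.truncn x).
  suff up : \forall x \near +oo, 1 - conv_cdf f k (Num.truncn x) <= (k%:R + e) * F x.
    by apply: (filterS2 _ _ low up) => x -> ->.
  clear low; elim: k e e0 => [|k IH] e e0.
    by near=> x; rewrite subrr mulr_ge0 ?stail_ge0// addr_ge0// ltW.
  pose c := e / (4 * (k%:R + 1 + e)).
  have kp : 0 < k%:R + 1 + e :> R by rewrite addr_gt0// ltr_wpDl.
  have c0 : 0 < c by rewrite divr_gt0// mulr_gt0.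
  have [q /andP[q0 q1] qc] := powRN_near1_lt alpha0 c0.
  have q'0 : 0 < 1 - q by rewrite subr_gt0.
  pose D : R := (1 - q) `^ (- alpha) + 1.
  have D0 : 0 < D by rewrite ltr_wpDl// powR_ge0.
  have e20 : 0 < e / 2 by rewrite divr_gt0.
  near=> x.
  have x0 : 0 < x by near: x; exact: (nbhs_pinfty_gt (num_real _)).
  have Fx : 0 <= F x by exact: stail_ge0.
  have jl : (Num.truncn ((1 - q) * x) + Num.truncn (q * x) <= Num.truncn x)%N.
    rewrite truncn_ge_nat ?(ltW x0)// natrD.
    have /andP[h1 _] := truncn_itv (ltW (mulr_gt0 q'0 x0)).
    have /andP[h2 _] := truncn_itv (ltW (mulr_gt0 q0 x0)).
    by apply: (le_trans (lerD h1 h2)); rewrite -mulrDl subrK mul1r.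
  apply: (le_trans (conv_tail_two_jumps f_ge0 f_le1 k jl)); rewrite !stail_truncn.
  have h1 : F (q * x) <= (1 + c) * F x by near: x; exact: (rv_le rF).
  have h2 : 1 - conv_cdf f k (Num.truncn (q * x)) <= (k%:R + e / 2) * F (q * x).
    by near: x; exact: (near_pinfty_scale q0 (IH _ e20)).
  have h3 : 1 - conv_cdf f k (Num.truncn ((1 - q) * x)) <=
      (k%:R + e / 2) * F ((1 - q) * x).
    by near: x; exact: (near_pinfty_scale q'0 (IH _ e20)).
  have h4 : F ((1 - q) * x) <= D * F x.
    by near: x; apply: (rv_le rF) => //; rewrite ltrDl.
  have h5 : F ((1 - q) * x) < e / (4 * D * (k%:R + 1 + e)).
    by near: x; apply: Fsmall => //; rewrite divr_gt0 ?mulr_gt0.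
  have G0 := stail_ge0 f_le1 ((1 - q) * x).
  have ke : 0 <= k%:R + e / 2 by rewrite addr_ge0// ltW.
  have h6 : F ((1 - q) * x) * (1 - conv_cdf f k (Num.truncn ((1 - q) * x)))
      <= e / 4 * F x.
    apply: (@le_trans _ _ (D * F x *
        ((k%:R + e / 2) * (e / (4 * D * (k%:R + 1 + e)))))).
      apply: ler_pM => //; first by rewrite subr_ge0 conv_cdf_le1.
      by rewrite (le_trans h3)// ler_wpM2l// ltW.
    rewrite [leLHS](_ : _ =
        ((k%:R + e / 2) / (k%:R + 1 + e)) * (e / 4 * F x)); last first.
      by field; rewrite !gt_eqF.
    rewrite ler_piMl//; first by rewrite mulr_ge0// divr_ge0 ?ltW.
    rewrite ler_pdivrMr// mul1r; lra.
  have h7 : (k%:R + 1 + e / 2) * F (q * x) <= (k%:R + 1 + e / 2 + e / 4) * F x.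
    apply: (@le_trans _ _ ((k%:R + 1 + e / 2) * ((1 + c) * F x))).
      by rewrite ler_wpM2l// !addr_ge0// ltW.
    rewrite mulrA ler_wpM2r// mulrDr mulr1 lerD2l /c.
    rewrite [leLHS](_ : _ =
        ((k%:R + 1 + e / 2) / (k%:R + 1 + e)) * (e / 4)); last first.
      by field; rewrite gt_eqF.
    rewrite ler_piMl//; first by rewrite divr_ge0 ?ltW.
    rewrite ler_pdivrMr// mul1r; lra.
  rewrite -(natr1 k).
  apply: (@le_trans _ _ ((k%:R + 1 + e / 2) * F (q * x) + e / 4 * F x)); lra.
near=> x.
have F1 : 0 <= F x <= 1 by rewrite stail_ge0// stail_le1.
have F2 : F x < e / (k%:R + 1) ^+ 2.
  near: x; apply: (cvgr_lt _ F0); rewrite divr_gt0// exprn_gt0//; exact: ltr_wpDl.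
have H := conv_cdf_le f_ge0 k (Num.truncn x); rewrite stail_truncn in H.
have {}H := le_trans H (expr_1B_le k F1).
case/andP: F1 => F10 _.
have k1 : 0 < (k%:R + 1 : R) ^+ 2 by apply: exprn_gt0; exact: ltr_wpDl.
move: F2; rewrite ltr_pdivlMr// => F2.
have ke : k%:R ^+ 2 * F x <= e.
  apply: le_trans (ltW F2); rewrite mulrC ler_wpM2l// ler_pXn2r ?nnegrE ?addr_ge0//.
  by rewrite lerDl.
have h : (k%:R * F x) ^+ 2 <= e * F x.
  by rewrite exprMn (expr2 (F x)) mulrA ler_wpM2r.
by rewrite mulrBl; move: H h; move: (conv_cdf _ _ _) (_ ^+ 2) => a b; lra.
Unshelve. all: by end_near. Qed.

(** Sums of nonnegative variables have no large downward deviations, even without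
second moments: with [m'] between [m / q] and [m], the Laplace transform of a
summand at a small [s] is at most exp (- s m'), by truncating the mean at a level
[N] and using exp (- u) <= 1 - u (1 - v) for 0 <= u <= v. *)
Lemma conv_cdf_lln m q e : is_mean m -> 0 < m -> 1 < q -> 0 < e ->
  \forall x \near +oo, forall k, q * x <= k%:R * m ->
    conv_cdf f k (Num.truncn x) <= e.
Proof.
move=> fm m0 q1 e0.
have q0 : 0 < q := lt_trans ltr01 q1.
pose m' := m * (1 + q^-1) / 2.
have m'0 : 0 < m' by rewrite divr_gt0// mulr_gt0// addr_gt0 ?invr_gt0.
have m'm : m' < m.
  have : q^-1 < 1 by rewrite invf_lt1.
  rewrite /m'; nra.
have mm' : 0 < m - m' by rewrite subr_gt0.
have [N _ /(_ _ (leqnn N))] := is_mean_ge fm mm'; rewrite subKr => muN.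
set mu := \sum_(i < N) i%:R * f i in muN.
have mu0 : 0 < mu := lt_trans m'0 muN.
have N0 : 0 < N%:R :> R.
  rewrite ltr0n lt0n; apply: contraTN muN => /eqP N0.
  by rewrite -leNgt /mu N0 big_ord0 ltW.
pose s := (mu - m') / (mu * N%:R).
have s0 : 0 < s by rewrite divr_gt0 ?subr_gt0 ?mulr_gt0.
have sN : (1 - s * N%:R) * mu = m' by rewrite /s; field; rewrite !gt_eqF.
have sN1 : 0 <= 1 - s * N%:R by rewrite -(pmulr_lge0 _ mu0) sN ltW.
clearbody s.
have laplace M : \sum_(i < M) f i * expR (- (s * i%:R)) <= expR (- (s * m')).
  apply: (@le_trans _ _ (\sum_(i < maxn M N) f i * expR (- (s * i%:R)))).
    rewrite (big_ord_widen _ (fun i => f i * expR (- (s * i%:R))) (leq_maxl M N)).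
    rewrite big_mkcond/= ler_sum// => i _; case: ifP => // _.
    by rewrite mulr_ge0 ?expR_ge0.
  apply: (@le_trans _ _ (\sum_(i < maxn M N)
      (f i - (if (i < N)%N then s * (1 - s * N%:R) * (i%:R * f i) else 0)))).
    apply: ler_sum => i _; have si0 : 0 <= s * i%:R by rewrite mulr_ge0// ltW.
    case: ifPn => [iN|_]; last first.
      by rewrite subr0 ler_piMr// -[leRHS]expR0 ler_expR lerNl oppr0.
    rewrite (_ : f i - _ = f i * (1 - s * i%:R * (1 - s * N%:R))); last by ring.
    rewrite ler_wpM2l// expRN -div1r ler_pdivrMr ?expR_gt0//.
    have h1 : 1 + s * i%:R <= expR (s * i%:R) by exact: expR_ge1Dx.
    have h2 : s * i%:R <= s * N%:R by rewrite ler_pM2l// ler_nat ltnW.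
    move: si0 h1 h2 sN1; move: (s * i%:R) (s * N%:R) (expR _) => u v w u0 h1 h2 h3.
    apply: (@le_trans _ _ ((1 - u * (1 - v)) * (1 + u))); first by nra.
    rewrite ler_wpM2l// subr_ge0; nra.
  rewrite sumrB -big_mkcond/=.
  rewrite -(big_ord_widen _ (fun i => s * (1 - s * N%:R) * (i%:R * f i))
    (leq_maxr M N)).
  rewrite -mulr_sumr -/mu -mulrA sN.
  by apply: le_trans (expR_ge1Dx _); rewrite lerD2r f_le1.
near=> x => k qxk.
have x0 : 0 < x by near: x; exact: (nbhs_pinfty_gt (num_real _)).
rewrite (le_trans (conv_cdf_chernoff f_ge0 _ _ (ltW s0) laplace))//.
have c0 : 0 < s * ((q - 1) / 2) by rewrite mulr_gt0// divr_gt0// subr_gt0.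
have xe : - ln e / (s * ((q - 1) / 2)) <= x.
  by near: x; exact: (nbhs_pinfty_ge (num_real _)).
rewrite -expRM_natl -expRD -[leRHS]lnK ?posrE// ler_expR.
have /andP[tx _] := truncn_itv (ltW x0).
have h1 : s * (Num.truncn x)%:R <= s * x by rewrite ler_pM2l.
have h2 : s * (x * ((1 + q) / 2)) <= k%:R * (s * m').
  rewrite (_ : x * _ = q * x * (m' / m)).
    rewrite [leRHS]mulrCA ler_pM2l//; apply: le_trans (_ : k%:R * m * (m' / m) <= _).
      by rewrite ler_pM2r// divr_gt0.
    by rewrite le_eqVlt; apply/orP; left; apply/eqP; field; rewrite gt_eqF.
  by rewrite /m'; field; rewrite !gt_eqF.
have h3 : - ln e <= x * (s * ((q - 1) / 2)) by rewrite -ler_pdivrMr.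
rewrite mulrN; lra.
Unshelve. all: by end_near. Qed.

End one_law.
End random_sums.

(** * The tail of a random sum *)

Section random_sum_tail.
Context {R : realType}.
Variables f p : nat -> R.
Hypothesis f_ge0 : forall i, 0 <= f i.
Hypothesis f_le1 : forall n, \sum_(i < n) f i <= 1.
Hypothesis p_ge0 : forall i, 0 <= p i.
Hypothesis p_le1 : forall n, \sum_(i < n) p i <= 1.
Variables (alpha m a : R) (Q : R -> R).
Hypothesis alpha_ge0 : 0 <= alpha.
Hypothesis rF : rv_function (stail f) alpha.
Hypothesis rG : rv_function (stail p) alpha.
Hypothesis F_to0 : stail f x @[x --> +oo] --> 0.
Hypothesis f_mean : is_mean f m.
Hypothesis p_mean : is_mean p a.
Hypothesis m_gt0 : 0 < m.
Hypothesis a_gt0 : 0 < a.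
Let F := stail f.
Let G := stail p.
Let T k (x : R) := 1 - conv_cdf f k (Num.truncn x).
(** The tail [Q] of the random sum is known through these two bounds, for every
cut-off [M] on the number N of summands: for N <= M the sum is treated exactly, and
for N > M it is at least the sum of the first [M] terms. *)
Hypothesis Q_ge : forall M x, 0 <= x ->
  \sum_(k < M.+1) p k * T k x + G M%:R * T M x <= Q x.
Hypothesis Q_le : forall M x, 0 <= x ->
  Q x <= \sum_(k < M.+1) p k * T k x + G M%:R.

Let T_ge0 k x : 0 <= T k x.
Proof. by rewrite subr_ge0 conv_cdf_le1. Qed.

Let minv_ge0 : 0 <= m^-1.
Proof. by rewrite invr_ge0 ltW. Qed.

(** Here the cut-off is [q * x / m] with q < 1, and [K] is such that the part of the
mean of N coming from values above [K] is below [e' / C]. *)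
Lemma random_sum_tail_le e : 0 < e ->
  \forall x \near +oo, Q x <= (1 + e) * (a * F x + m `^ alpha * G x).
Proof.
move=> e0.
have [q /andP[q0 q1] qe] := powRN_near1_lt alpha_ge0 e0.
have [C C0 hC] := conv_tail_uniform f_ge0 f_le1 rF alpha_ge0 (is_mean_le f_ge0 f_mean)
  m_gt0 q0 q1.
pose e' := e * a / 3.
have e'0 : 0 < e' by rewrite divr_gt0// mulr_gt0.
have e'C : 0 < e' / C by rewrite divr_gt0.
have [K _ /(_ _ (leqnn K))/= hK] := is_mean_ge p_mean e'C.
have fixedk : \forall x \near +oo, forall k : 'I_K, T k x <= (k%:R + e') * F x.
  apply: filter_forall => k.
  have := conv_tail_fixed f_ge0 f_le1 k rF alpha_ge0 F_to0 e'0.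
  by apply: filterS => x /andP[].
have qm0 : 0 < q / m by rewrite divr_gt0.
near=> x.
have x0 : 0 <= x by near: x; exact: (nbhs_pinfty_ge (num_real _)).
have Fx : 0 <= F x by exact: stail_ge0.
have hCx : forall k : nat, k%:R * m <= q * x -> T k x <= C * k%:R * F x.
  by near: x; exact: hC.
have fixedkx : forall k : 'I_K, T k x <= (k%:R + e') * F x by near: x; exact: fixedk.
have qmx : 0 <= q / m * x := mulr_ge0 (ltW qm0) x0.
set M := Num.truncn (q / m * x).
have KM : (K <= M.+1)%N.
  apply: leqW; rewrite truncn_ge_nat//.
  rewrite mulrC -ler_pdivrMr//; near: x; exact: (nbhs_pinfty_ge (num_real _)).
have GM : G M%:R <= (1 + e) * m `^ alpha * G x.
  rewrite /G stail_truncn; near: x; apply: (rv_le rG) => //.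
  rewrite (powRM _ (ltW q0) minv_ge0) -(powR_inv1 (ltW m_gt0)) -powRrM.
  by rewrite mulrNN mul1r ltr_pM2r// powR_gt0.
apply: (le_trans (Q_le M x0)); rewrite mulrDr mulrA [_ * (_ * G x)]mulrA lerD//.
pose b (k : nat) := F x * (k%:R * p k) + e' * F x * p k
  + (if (k < K)%N then 0 else C * F x * (k%:R * p k)).
apply: (@le_trans _ _ (\sum_(k < M.+1) b k)).
  apply: ler_sum => k _; rewrite /b; case: ifPn => kK.
    rewrite addr0 [leRHS](_ : _ = p k * ((k%:R + e') * F x)); last by ring.
    by rewrite ler_wpM2l// (fixedkx (Ordinal kK)).
  rewrite [leRHS](_ : _ = p k * (k%:R * F x + e' * F x + C * k%:R * F x)); last by ring.
  rewrite ler_wpM2l// (le_trans (hCx k _))//.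
    rewrite -ler_pdivlMr// mulrAC -truncn_ge_nat//.
    by rewrite -ltnS ltn_ord.
  by rewrite lerDr addr_ge0// mulr_ge0// ltW.
have sum1 : \sum_(k < M.+1) k%:R * p k =
    \sum_(k < K) k%:R * p k + \sum_(k < M.+1 | ~~ (k < K)%N) k%:R * p k.
  rewrite (bigID (fun k : 'I_M.+1 => (k < K)%N))/=.
  by rewrite -(big_ord_widen _ (fun k => k%:R * p k) KM).
have sum2 := is_mean_le p_ge0 p_mean M.+1.
have sum3 : C * F x * \sum_(k < M.+1 | ~~ (k < K)%N) k%:R * p k <= e' * F x.
  rewrite mulrAC ler_wpM2r// mulrC -ler_pdivlMr//; lra.
have -> : \sum_(k < M.+1) b k = F x * (\sum_(k < M.+1) k%:R * p k)
    + e' * F x * \sum_(k < M.+1) p k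
    + C * F x * \sum_(k < M.+1 | ~~ (k < K)%N) k%:R * p k.
  rewrite !mulr_sumr [X in _ = _ + X]big_mkcond/= -!big_split/=.
  by apply: eq_bigr => k _; rewrite /b; case: ifP.
have h1 : F x * (\sum_(k < M.+1) k%:R * p k) <= F x * a by rewrite ler_wpM2l.
have h2 : e' * F x * \sum_(k < M.+1) p k <= e' * F x.
  by rewrite ler_piMr// mulr_ge0// ltW.
have h3 : 2 * (e' * F x) <= e * a * F x.
  by rewrite mulrA ler_wpM2r// /e'; move: (mulr_gt0 e0 a_gt0); move: (e * a) => ea; lra.
have -> : (1 + e) * a * F x = a * F x + e * a * F x by ring.
by move: h1 h2 h3 sum3; rewrite (mulrC (F x) a); lra.
Unshelve. all: by end_near. Qed.

(** Here the cut-off is just above [q * x / m] with q > 1, and sums of more than [K]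
but at most [M] terms are neglected. *)
Lemma random_sum_tail_ge e : 0 < e ->
  \forall x \near +oo, (1 - e) * (a * F x + m `^ alpha * G x) <= Q x.
Proof.
move=> e0.
(* at most [e / 2] and below 1, although [e] may be large *)
pose e1 := e / (2 * (1 + e)).
have e10 : 0 < e1 by rewrite divr_gt0// mulr_gt0// addr_gt0.
have e1e : e1 < e / 2 by rewrite /e1 ltr_pdivrMr ?mulr_gt0 ?addr_gt0//; nra.
have e11 : e1 < 1 by rewrite /e1 ltr_pdivrMr ?mulr_gt0 ?addr_gt0//; lra.
have [q' q'1 qe] := powRN_near1_gt alpha_ge0 e10.
(* the gap between [q] and [q'] leaves room for rounding [q * x / m] up *)
pose q := (1 + q') / 2.
have q1 : 1 < q by rewrite /q; lra.
have q0 : 0 < q := lt_trans ltr01 q1.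
have q'0 : 0 < q' := lt_trans ltr01 q'1.
have lln := conv_cdf_lln f_ge0 f_le1 f_mean m_gt0 q1 e10.
pose e' := e * a / 3.
have e'0 : 0 < e' by rewrite divr_gt0// mulr_gt0.
have [K _ /(_ _ (leqnn K))/= hK] := is_mean_ge p_mean e'0.
have fixedk : \forall x \near +oo, forall k : 'I_K, (k%:R - e') * F x <= T k x.
  apply: filter_forall => k.
  have := conv_tail_fixed f_ge0 f_le1 k rF alpha_ge0 F_to0 e'0.
  by apply: filterS => x /andP[].
have qm0 : 0 < q / m by rewrite divr_gt0.
have q'm0 : 0 < q' / m by rewrite divr_gt0.
near=> x.
have x0 : 0 <= x by near: x; exact: (nbhs_pinfty_ge (num_real _)).
have Fx : 0 <= F x by exact: stail_ge0.
have Gx : 0 <= G x by exact: stail_ge0.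
have llnx : forall k : nat, q * x <= k%:R * m -> conv_cdf f k (Num.truncn x) <= e1.
  by near: x; exact: lln.
have fixedkx : forall k : 'I_K, (k%:R - e') * F x <= T k x by near: x; exact: fixedk.
have qmx : 0 <= q / m * x := mulr_ge0 (ltW qm0) x0.
set M := (Num.truncn (q / m * x)).+1.
have KM : (K <= M.+1)%N.
  rewrite /M; apply: leqW; apply: leqW; rewrite truncn_ge_nat//.
  rewrite mulrC -ler_pdivrMr//; near: x; exact: (nbhs_pinfty_ge (num_real _)).
have Mq' : M%:R <= q' / m * x.
  have /andP[h _] := truncn_itv qmx.
  rewrite /M -natr1; apply: (@le_trans _ _ (q / m * x + 1)); first by rewrite lerD2r.
  have : ((q' - q) / m)^-1 <= x by near: x; exact: (nbhs_pinfty_ge (num_real _)).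
  have d0 : 0 < (q' - q) / m by rewrite divr_gt0// /q; lra.
  rewrite -[X in X <= _]mul1r ler_pdivrMr// mulrBl; lra.
have GM : (1 - e1) * m `^ alpha * G x <= G M%:R.
  apply: le_trans (stail_homo p_ge0 Mq'); near: x; apply: (rv_ge rG) => //.
  rewrite (powRM _ (ltW q'0) minv_ge0) -(powR_inv1 (ltW m_gt0)) -powRrM.
  by rewrite mulrNN mul1r ltr_pM2r// powR_gt0.
have TM : 1 - e1 <= T M x.
  rewrite lerB// llnx// -ler_pdivrMr// mulrAC; exact: ltW (truncnS_gt _).
apply: le_trans (Q_ge M x0); rewrite mulrDr lerD//; last first.
  apply: (@le_trans _ _ ((1 - e1) * m `^ alpha * G x * (1 - e1))); last first.
    by rewrite ler_pM// ?mulr_ge0 ?powR_ge0 ?subr_ge0// ltW.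
  rewrite [leRHS](_ : _ = (1 - e1) ^+ 2 * (m `^ alpha * G x)); last by ring.
  rewrite ler_wpM2r//; first exact: mulr_ge0 (powR_ge0 _ _) Gx.
  nra.
apply: (@le_trans _ _ (\sum_(k < K) p k * ((k%:R - e') * F x))); last first.
  rewrite (big_ord_widen _ (fun k => p k * ((k%:R - e') * F x)) KM) big_mkcond/=.
  apply: ler_sum => k _; case: ifPn => kK; last by rewrite mulr_ge0.
  by rewrite ler_wpM2l// (fixedkx (Ordinal kK)).
have -> : \sum_(k < K) p k * ((k%:R - e') * F x) =
    F x * (\sum_(k < K) k%:R * p k) - F x * e' * \sum_(k < K) p k.
  by rewrite !mulr_sumr -sumrB; apply: eq_bigr => k _; ring.
have h1 : F x * a - F x * e' <= F x * (\sum_(k < K) k%:R * p k).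
  by rewrite -mulrBr ler_wpM2l// ltW.
have h2 : F x * e' * (\sum_(k < K) p k) <= F x * e'.
  by rewrite ler_piMr// mulr_ge0// ltW.
have h3 : 2 * (F x * e') <= e * (a * F x).
  rewrite /e' [leLHS](_ : _ = 2 / 3 * (e * (a * F x))); last by field.
  by rewrite ler_piMl ?mulr_ge0 ?(ltW e0) ?(ltW a_gt0)//; lra.
rewrite [leLHS](_ : _ = F x * a - e * (a * F x)); last by ring.
by move: h1 h2 h3; lra.
Unshelve. all: by end_near. Qed.

Lemma random_sum_tail :
  asymp_equiv Q (fun x => a * F x + m `^ alpha * G x).
Proof.
apply/asymp_equivP.
  apply: (filterS2 _ _ (rv_near_gt0 rF) (rv_near_gt0 rG)) => x Fx Gx.
  by rewrite addr_gt0// mulr_gt0// powR_gt0.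
move=> e e0.
by apply: (filterS2 _ _ (random_sum_tail_ge e0) (random_sum_tail_le e0)) => x -> ->.
Qed.

End random_sum_tail.

(** * Asymptotic equivalence and light-tailed perturbations *)

Section asymptotic_algebra.
Context {R : realType}.
Implicit Types (F G H f g h : R -> R) (alpha c d e q : R).

Lemma asymp_equiv_near_gt0 f g : asymp_equiv f g ->
  (\forall x \near +oo, 0 < g x) -> \forall x \near +oo, 0 < f x.
Proof.
move=> fg g0; have half0 : 0 < 2^-1 :> R by rewrite invr_gt0.
have := (asymp_equivP f g0).1 fg _ half0.
by apply: (filterS2 _ _ g0) => x gx /andP[+ _]; apply: lt_le_trans;
  rewrite mulr_gt0//; lra.
Qed.

Lemma asymp_equiv_trans f g h : (\forall x \near +oo, 0 < g x) ->
  asymp_equiv f g -> asymp_equiv g h -> asymp_equiv f h.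
Proof.
move=> g0 fg gh; rewrite /asymp_equiv -[X in _ --> X](mulr1 1).
apply: cvg_trans (cvgM fg gh); apply: near_eq_cvg.
by apply: filterS g0 => x gx /=; rewrite mulrA divfK// gt_eqF.
Qed.

Lemma asymp_equivD f1 f2 g1 g2 :
  (\forall x \near +oo, 0 < g1 x) -> (\forall x \near +oo, 0 < g2 x) ->
  asymp_equiv f1 g1 -> asymp_equiv f2 g2 ->
  asymp_equiv (fun x => f1 x + f2 x) (fun x => g1 x + g2 x).
Proof.
move=> g10 g20 /(asymp_equivP _ g10) fg1 /(asymp_equivP _ g20) fg2.
apply/asymp_equivP => [|e e0].
  by apply: (filterS2 _ _ g10 g20) => x; exact: addr_gt0.
apply: (filterS2 _ _ (fg1 _ e0) (fg2 _ e0)) => x /andP[a1 b1] /andP[a2 b2].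
by rewrite !mulrDr !lerD.
Qed.

Lemma asymp_equivM2l c f g : c != 0 -> asymp_equiv f g ->
  asymp_equiv (fun x => c * f x) (fun x => c * g x).
Proof.
move=> c0; rewrite /asymp_equiv; apply: cvg_trans; apply: near_eq_cvg.
by apply: nearW => x /=; rewrite invfM mulrACA divff// mul1r.
Qed.

Lemma asymp_equiv_refl f : (\forall x \near +oo, 0 < f x) -> asymp_equiv f f.
Proof.
move=> f0; apply/asymp_equivP => // e e0; apply: filterS f0 => x fx.
by apply/andP; split; nra.
Qed.

Lemma asymp_equiv_scale f g q : 0 < q -> asymp_equiv f g ->
  asymp_equiv (fun x => f (q * x)) (fun x => g (q * x)).
Proof.
move=> q0 fg.
have qoo : q * x @[x --> +oo] --> +oo by move=> A hA; exact: (near_pinfty_scale q0 hA).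
exact: (cvg_comp _ _ qoo fg).
Qed.

Lemma ratio_asymp_equiv f g c : 0 < c ->
  (f x / g x @[x --> +oo] --> c) <-> asymp_equiv f (fun x => c * g x).
Proof.
move=> c0; have cn0 : c != 0 by rewrite gt_eqF.
split=> h.
  have : c^-1 * (f x / g x) @[x --> +oo] --> c^-1 * c by exact: cvgMl_tmp h.
  rewrite mulVf// /asymp_equiv; apply: cvg_trans; apply: near_eq_cvg.
  by apply: nearW => x /=; rewrite invfM mulrCA mulrA.
have : c * (f x / (c * g x)) @[x --> +oo] --> c * 1 by exact: cvgMl_tmp h.
rewrite mulr1; apply: cvg_trans; apply: near_eq_cvg.
by apply: nearW => x /=; rewrite invfM mulrCA mulVKf.
Qed.

Lemma rv_asymp_equiv F alpha q : rv_function F alpha -> 0 < q ->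
  asymp_equiv (fun x => F (q * x)) (fun x => q `^ (- alpha) * F x).
Proof.
case=> _ _ h q0.
exact: ((ratio_asymp_equiv _ _ (powR_gt0 (- alpha) q0)).1 (h _ q0)).
Qed.

Lemma rv_asymp_closed F H alpha : {homo F : x y / x <= y >-> y <= x} ->
  rv_function H alpha -> asymp_equiv F H -> rv_function F alpha.
Proof.
move=> dF rH FH; have H0 := rv_near_gt0 rH.
have F0 := asymp_equiv_near_gt0 FH H0.
split=> // [x x0|q q0].
  have /near_pinfty_ge[x0' _ h] := F0.
  apply: lt_le_trans (h (Num.max x0' x) _) _; first by rewrite le_max lexx.
  by apply: dF; rewrite le_max lexx orbT.
apply/(ratio_asymp_equiv _ _ (powR_gt0 (- alpha) q0)).
have HF : asymp_equiv H F.
  rewrite /asymp_equiv -[X in _ --> X]invr1.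
  have -> : (fun x => H x / F x) = (fun x => (F x / H x)^-1).
    by apply/funext => x; rewrite invfM invrK mulrC.
  exact: cvgV.
have q'0 : 0 < q `^ (- alpha) by exact: powR_gt0.
apply: (@asymp_equiv_trans _ (fun x => H (q * x))).
- exact: near_pinfty_scale q0 H0.
- exact: asymp_equiv_scale.
apply: (@asymp_equiv_trans _ (fun x => q `^ (- alpha) * H x)).
- by apply: filterS H0 => x Hx; rewrite mulr_gt0.
- exact: rv_asymp_equiv.
- by apply: asymp_equivM2l => //; rewrite gt_eqF.
Qed.

Lemma rv_function_lin F G alpha c d : 0 < c -> 0 < d ->
  rv_function F alpha -> rv_function G alpha ->
  rv_function (fun x => c * F x + d * G x) alpha.
Proof.
move=> c0 d0 rF rG; have [dF F0 _] := rF; have [dG G0 _] := rG.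
split=> [x y xy|x x0|q q0].
- by rewrite lerD// ler_pM2l// ?dF ?dG.
- by rewrite addr_gt0// mulr_gt0// ?F0 ?G0.
have q'0 : 0 < q `^ (- alpha) by exact: powR_gt0.
apply/(ratio_asymp_equiv _ _ q'0).
have -> : (fun x => q `^ (- alpha) * (c * F x + d * G x)) =
    (fun x => c * (q `^ (- alpha) * F x) + d * (q `^ (- alpha) * G x)).
  by apply/funext => x; ring.
apply: asymp_equivD.
- by apply: filterS (rv_near_gt0 rF) => x Fx; rewrite !mulr_gt0.
- by apply: filterS (rv_near_gt0 rG) => x Gx; rewrite !mulr_gt0.
- by apply: asymp_equivM2l; [rewrite gt_eqF|exact: rv_asymp_equiv].
- by apply: asymp_equivM2l; [rewrite gt_eqF|exact: rv_asymp_equiv].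
Qed.

(** Comparison with x^(- rho) for rho strictly between [alpha] and [r]. *)
Lemma rv_ge_power H alpha r K c : rv_function H alpha -> 0 <= alpha -> alpha < r ->
  0 < c -> \forall x \near +oo, K * x `^ (- r) <= c * H x.
Proof.
move=> rH alpha0 ar c0; pose rho := (alpha + r) / 2.
have rho0 : 0 <= rho by rewrite /rho; lra.
have arho : alpha < rho by rewrite /rho; lra.
have d0 : 0 < r - rho by rewrite /rho; lra.
have [x0 x00 [C C0 hC]] := rv_almost_increasing rH rho0 arho.
have [_ H0 _] := rH.
pose D := x0 `^ rho * H x0.
have D0 : 0 < D by rewrite mulr_gt0 ?powR_gt0// H0.
pose K' := Num.max K 1.
have K'0 : 0 < K' by rewrite lt_max ltr01 orbT.
near=> x.
have x0x : x0 <= x by near: x; exact: (nbhs_pinfty_ge (num_real _)).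
have xp : 0 < x := lt_le_trans x00 x0x.
have h1 : D <= C * (x `^ rho * H x) by exact: hC.
have h2 : K' * C / (c * D) <= x `^ (r - rho).
  have E0 : 0 < K' * C / (c * D) by exact: divr_gt0 (mulr_gt0 K'0 C0) (mulr_gt0 c0 D0).
  have : (K' * C / (c * D)) `^ (r - rho)^-1 <= x.
    by near: x; exact: (nbhs_pinfty_ge (num_real _)).
  move=> /(ge0_ler_powR (ltW d0)).
  rewrite !nnegrE powR_ge0 (ltW xp) => /(_ isT isT).
  by rewrite -powRrM mulVf ?gt_eqF// powRr1// ltW.
apply: (@le_trans _ _ (K' * x `^ (- r))).
  by rewrite ler_wpM2r ?powR_ge0// le_max lexx.
rewrite powRN ler_pdivrMr ?powR_gt0//.
have -> : x `^ r = x `^ rho * x `^ (r - rho).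
  by rewrite -powRD ?(gt_eqF xp) ?implybT// [rho + _]addrC subrK.
move: h2; rewrite (ler_pdivrMr _ _ (mulr_gt0 c0 D0)) => h2.
have Hx : 0 < H x by exact: H0.
rewrite -(ler_pM2r D0).
apply: (@le_trans _ _ (K' * (C * (x `^ rho * H x)))); first by rewrite ler_pM2l.
rewrite [leLHS](_ : _ = K' * C * (x `^ rho * H x)); last by rewrite mulrA.
apply: (@le_trans _ _ (x `^ (r - rho) * (c * D) * (x `^ rho * H x))).
  by rewrite ler_pM2r// mulr_gt0// powR_gt0.
by rewrite le_eqVlt; apply/orP; left; apply/eqP; ring.
Unshelve. all: by end_near. Qed.

(** Adding a variable with tail [E] to one with tail [Q]: for the sum to exceed x,
one of them must exceed q x or (1 - q) x. The tail [E] is negligible, and the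
rescaling by q close to 1 is harmless by regular variation. *)
Lemma asymp_equiv_light_perturbation Q Y E H alpha r K :
  rv_function H alpha -> 0 <= alpha -> alpha < r -> asymp_equiv Q H ->
  (forall x, 0 < x -> E x <= K * x `^ (- r)) ->
  (forall x, 0 <= x -> Q x <= Y x) ->
  (forall q x, 0 < q < 1 -> 0 <= x -> Y x <= Q (q * x) + E ((1 - q) * x)) ->
  asymp_equiv Y H.
Proof.
move=> rH alpha0 ar QH EK QY YQE; have H0 := rv_near_gt0 rH.
have {}QH := (asymp_equivP _ H0).1 QH.
apply/asymp_equivP => // e e0.
(* small enough for [(1 + e1)^2 + e1 <= 1 + e] *)
pose e1 := e / (4 * (1 + e)).
have e10 : 0 < e1 by rewrite divr_gt0// mulr_gt0// addr_gt0.
have e1e : 4 * e1 <= e.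
  rewrite /e1 [leLHS](_ : _ = e / (1 + e)); last by field; rewrite gt_eqF// addr_gt0.
  by rewrite ler_pdivrMr ?addr_gt0//; nra.
have e11 : e1 <= 1.
  by rewrite /e1 ler_pdivrMr ?mulr_gt0 ?addr_gt0//; lra.
have [q /andP[q0 q1] qe] := powRN_near1_lt alpha0 e10.
have q'0 : 0 < 1 - q by rewrite subr_gt0.
near=> x.
have x0 : 0 < x by near: x; exact: (nbhs_pinfty_gt (num_real _)).
have Hx : 0 < H x by near: x.
apply/andP; split.
  have : (1 - e) * H x <= Q x <= (1 + e) * H x by near: x; exact: QH.
  by move=> /andP[h _]; rewrite (le_trans h)// QY// ltW.
have h1 : Q (q * x) <= (1 + e1) * H (q * x).
  have : (1 - e1) * H (q * x) <= Q (q * x) <= (1 + e1) * H (q * x).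
    by near: x; exact: (near_pinfty_scale q0 (QH _ e10)).
  by case/andP.
have h2 : H (q * x) <= (1 + e1) * H x by near: x; exact: (rv_le rH).
have h3 : E ((1 - q) * x) <= e1 * H x.
  rewrite (le_trans (EK _ _))//; first exact: mulr_gt0.
  rewrite powRM ?(ltW q'0) ?(ltW x0)// mulrA.
  by near: x; exact: rv_ge_power rH _ _ _.
apply: (le_trans (YQE q x _ (ltW x0))); first by rewrite q0.
apply: (le_trans (lerD h1 h3)).
apply: (@le_trans _ _ ((1 + e1) * ((1 + e1) * H x) + e1 * H x)).
  by rewrite lerD2r ler_wpM2l// addr_ge0// ltW.
rewrite mulrA -mulrDl ler_pM2r//; nra.
Unshelve. all: by end_near. Qed.

End asymptotic_algebra.

(** * Means of regularly varying laws *)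

Section finite_mean.
Context {R : realType}.
Variable p : nat -> R.
Hypothesis p_ge0 : forall i, 0 <= p i.
Hypothesis p_le1 : forall n, \sum_(i < n) p i <= 1.

Lemma psum_mean_le_stail N :
  \sum_(i < N) i%:R * p i <= \sum_(n < N) stail p n%:R.
Proof.
have -> : \sum_(i < N) i%:R * p i =
    \sum_(i < N) \sum_(n < N) (if (n < i)%N then p i else 0).
  apply: eq_bigr => i _; rewrite -big_mkcond/=.
  rewrite -(big_ord_widen N (fun=> p i) (ltnW (ltn_ord i))).
  by rewrite sumr_const card_ord mulr_natl.
rewrite exchange_big/=; apply: ler_sum => n _; rewrite -big_mkcond/=.
exact: (mass_le_stail p_ge0 p_le1 (A := fun i => n < i)%N).
Qed.

(** The partial sums [S N] of the tail over 0, ..., N - 1 satisfy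
S (2 N) <= 2 (G 0 + G 2 + ... + G (2 N - 2)) <= 2 n0 + th * S N with th < 1, because
G (2 n) <= (th / 2) G n for n >= n0 when alpha > 1; this bounds S. *)
Lemma rv_finite_mean alpha : rv_function (stail p) alpha -> 1 < alpha ->
  exists B, forall N, \sum_(i < N) i%:R * p i <= B.
Proof.
move=> rG alpha1; set G := stail p.
have two0 : 0 < 2 :> R by [].
pose th : R := 2 `^ (- alpha) + 2^-1.
have p2 : 2 `^ (- alpha) < 2^-1 :> R.
  rewrite -[ltRHS](powR_inv1 (ltW two0)) /powR gt_eqF// ltr_expR.
  by rewrite ltr_pM2r ?ltrN2// ln_gt0// ltr1n.
have th1 : th < 1 by rewrite /th; lra.
have th2 : 2 `^ (- alpha) < th / 2 by rewrite /th; lra.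
have th0 : 0 < th by rewrite /th ltr_wpDl// powR_ge0.
have /near_pinfty_ge[x0 x00 hx0] := rv_le rG two0 th2.
pose n0 := (Num.truncn x0).+1.
have G1 x : G x <= 1 by exact: stail_le1.
have G0 x : 0 <= G x by exact: stail_ge0.
pose S N := \sum_(n < N) G n%:R.
have S2 N : S (N + N)%N <= 2 * \sum_(n < N) G (2 * n%:R).
  elim: N => [|N IH]; first by rewrite /S !big_ord0 mulr0.
  rewrite addSn addnS /S !big_ord_recr/= mulrDr -addrA lerD//.
  have -> : (N + N)%:R = 2 * N%:R :> R by rewrite natrD; ring.
  have : G (N + N).+1%:R <= G (2 * N%:R).
    by apply: stail_homo => //; rewrite -(natr1 (N + N)%N) natrD; lra.
  lra.
have Sth N : \sum_(n < N) G (2 * n%:R) <= n0%:R + th / 2 * S N.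
  rewrite /S mulr_sumr.
  apply: (@le_trans _ _ (\sum_(n < N)
      ((if (n < n0)%N then 1 else 0) + th / 2 * G n%:R))).
    apply: ler_sum => n _; case: ifPn => nn0.
      by rewrite ler_wpDr// mulr_ge0// divr_ge0// ltW.
    rewrite add0r; apply: hx0; rewrite -leqNgt in nn0.
    by rewrite (le_trans (ltW (truncnS_gt x0)))// ler_nat.
  rewrite big_split/= lerD2r -big_mkcond/=.
  have [n0N|/ltnW Nn0] := leqP n0 N.
    by rewrite -(big_ord_widen N (fun=> 1) n0N) sumr_const card_ord.
  by rewrite sumr_const ler_nat (leq_trans (max_card _))// card_ord.
exists (2 * n0%:R / (1 - th)) => N.
apply: le_trans (psum_mean_le_stail N) _.
have SN : S N <= S (N + N)%N.
  rewrite /S (big_ord_widen _ (fun n => G n%:R) (leq_addr N N)) big_mkcond/=.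
  by apply: ler_sum => i _; case: ifP.
rewrite -/(S N) ler_pdivlMr ?subr_gt0//.
have := S2 N; have := Sth N; rewrite (_ : th / 2 * S N = th * S N / 2); last by ring.
rewrite (_ : S N * (1 - th) = S N - th * S N); last by ring.
by move: SN; move: (th * S N) (S N) (S (N + N)%N) (\sum_(n < N) _) => *; lra.
Qed.

Lemma is_mean_gt0 m : stail p x @[x --> +oo] --> 0 -> is_mean p m ->
  0 < stail p 0 -> 0 < m.
Proof.
move=> G0 pm Gp.
have /near_pinfty_ge[x0 _ h] : \forall x \near +oo, stail p x < stail p 0.
  exact: (cvgr_lt _ G0).
have {}h := h _ (lexx _); set N := Num.truncn x0.
apply: lt_le_trans (is_mean_le p_ge0 pm N.+1).
apply: (@lt_le_trans _ _ (stail p 0 - stail p x0)); first by rewrite subr_gt0.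
have -> : stail p 0 - stail p x0 = \sum_(i < N.+1) p i - p 0%N.
  by rewrite /stail truncn0 big_ord1; ring.
rewrite big_ord_recl/= addrAC subrr add0r.
rewrite big_ord_recl/= mul0r add0r; apply: ler_sum => i _.
by rewrite ler_peMl// ler1n.
Qed.

End finite_mean.

(** * Independence of events from subfamilies of variables *)

Section nat_valued.
Context {d : measure_display} {T : measurableType d} {R : realType}.
Variable P : probability T R.
Local Open Scope ereal_scope.
Implicit Types (N M : T -> nat) (A D : set T).

Definition nat_measurable N := forall B : set nat, measurable (N @^-1` B).

Lemma nat_measurable_rv (X : {RV P >-> nat}) : nat_measurable X.
Proof. by move=> B; exact: measurable_funPTI. Qed.

Lemma nat_measurable_op (op : nat -> nat -> nat) N M :
  nat_measurable N -> nat_measurable M -> nat_measurable (fun w => op (N w) (M w)).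
Proof.
move=> mN mM B.
have -> : (fun w => op (N w) (M w)) @^-1` B =
    \bigcup_i ((N @^-1` [set i]) `&` (M @^-1` [set j | B (op i j)])).
  by apply/seteqP; split => [w Bw|w [i _ [/= <-]]]; first by exists (N w).
by apply: bigcupT_measurable => i; apply: measurableI; [exact: mN|exact: mM].
Qed.

Lemma measure_partition A N : measurable A -> nat_measurable N ->
  P A = \sum_(0 <= k <oo) P (A `&` N @^-1` [set k]).
Proof.
move=> mA mN; rewrite -measure_semi_bigcup.
- by congr (P _); apply/seteqP; split => [w Aw|w [k _ []]//]; exists (N w).
- by move=> k; apply: measurableI.
- exact: trivIset_preimage1_in.
- by apply: bigcupT_measurable => k; apply: measurableI.
Qed.

Lemma measure_partition_lt A N n : measurable A -> nat_measurable N ->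
  P (A `&` [set w | (N w < n)%N]) = \sum_(k < n) P (A `&` N @^-1` [set (k : nat)]).
Proof.
move=> mA mN; rewrite -measure_bigsetU_ord.
- rewrite -(bigcup_mkord n (fun k => A `&` N @^-1` [set k])); congr (P _).
  apply/seteqP; split => [w [Aw Nw]|w].
    by exists (N w).
  by case=> k /= kn [Aw Nw]; split => //=; rewrite Nw.
- by move=> k; apply: measurableI.
- by move=> i j _ _ [w [[_ /= Ni] [_ /= Nj]]]; apply: val_inj; rewrite /= -Ni.
Qed.

Lemma measure_fin D : measurable D -> P D = (fine (P D))%:E.
Proof. by move=> mD; rewrite fineK// fin_num_measure. Qed.

Lemma nat_measurable_fun N A (h : nat -> R) : measurable A -> nat_measurable N ->
  measurable_fun A (EFin \o (h \o N)).
Proof.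
move=> mA mN; apply: (@measurable_funS _ _ _ _ setT) => //.
apply/measurable_EFinP.
have mh : measurable_fun [set: nat] h by [].
by apply: (measurableT_comp mh) => _ B _; rewrite setTI; exact: mN.
Qed.

Lemma integral_nat_rv A N : measurable A -> nat_measurable N ->
  \int[P]_(w in A) (N w)%:R%:E =
  \sum_(0 <= k <oo) k%:R%:E * P (A `&` N @^-1` [set k]).
Proof.
move=> mA mN.
have eA : A = \bigcup_k (A `&` N @^-1` [set k]).
  by apply/seteqP; split => [w Aw|w [k _ []]//]; exists (N w).
have mAk k : measurable (A `&` N @^-1` [set k]) by exact: measurableI.
rewrite [in LHS]eA ge0_integral_bigcup//; last first.
- exact: trivIset_preimage1_in.
- by rewrite -eA; exact: (nat_measurable_fun (fun k => k%:R)).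
apply: eq_eseriesr => k _; rewrite -integral_cst//.
by apply: eq_integral => w; rewrite inE => -[_ /= ->].
Qed.

End nat_valued.

Section independence.
Context {d : measure_display} {T : measurableType d} {R : realType}.
Variable P : probability T R.
Variables (I : eqType) (Y : I -> {RV P >-> nat}).
Hypothesis Y_indep : mutually_independent Y.
Local Open Scope ereal_scope.
Implicit Types (D : set T) (J : set I) (s : seq I) (B : I -> set nat).

Definition cylinder s B := \bigcap_(i in [set` s]) (Y i @^-1` B i).

Lemma cylinder_cons i s B : cylinder (i :: s) B = Y i @^-1` B i `&` cylinder s B.
Proof.
apply/seteqP; split => [w h|w [h1 h2] j /=].
  split; first by apply: (h i) => /=; exact: mem_head.
  by move=> j /= js; apply: (h j) => /=; rewrite inE js orbT.
by rewrite inE => /predU1P[->//|js]; exact: h2.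
Qed.

Lemma measurable_cylinder s B : measurable (cylinder s B).
Proof.
elim: s => [|i s IH]; last first.
  by rewrite cylinder_cons; apply: measurableI => //; exact: nat_measurable_rv.
by rewrite (_ : cylinder _ _ = setT)//; apply/seteqP; split => // w _ j.
Qed.

(** Independence of an event from the variables with index in [J], tested on
cylinders. The events of a Galton--Watson process at a given time are built from
the input variables by the operations studied below; conditioning on the value
of an input removes its index from [J]. *)
Definition indep_of D J := measurable D /\ forall s B, uniq s ->
  (forall i, i \in s -> J i) ->
  P (D `&` cylinder s B) = P D * \prod_(i <- s) P (Y i @^-1` B i).

Lemma indep_of_measurable D J : indep_of D J -> measurable D.
Proof. by case. Qed.

Lemma indep_ofT J : indep_of setT J.
Proof.
by split=> // s B us _; rewrite setTI probability_setT mul1e; exact: Y_indep.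
Qed.

Lemma indep_of0 J : indep_of set0 J.
Proof. by split=> // s B _ _; rewrite set0I measure0 mul0e. Qed.

Lemma indep_ofS D J J' : J' `<=` J -> indep_of D J -> indep_of D J'.
Proof. by move=> JJ [mD h]; split=> // s B us sJ; apply: h => // i /sJ /JJ. Qed.

Lemma indep_ofE D J i b : indep_of D J -> J i ->
  P (D `&` Y i @^-1` b) = P D * P (Y i @^-1` b).
Proof.
move=> [_ h] Ji; have := h [:: i] (fun=> b) isT.
rewrite big_seq1 cylinder_cons [cylinder [::] _](_ : _ = setT) ?setIT; last first.
  by apply/seteqP; split => // w _ j.
by apply=> j; rewrite inE => /eqP ->.
Qed.

Lemma indep_ofI D J i b : indep_of D J -> J i ->
  indep_of (D `&` Y i @^-1` b) (J `\ i).
Proof.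
move=> hD Ji; have [mD h] := hD.
split=> [|s B us sJ]; first by apply: measurableI => //; exact: nat_measurable_rv.
have si : i \notin s by apply/negP => /sJ[_]; apply.
pose B' j := if j == i then b else B j.
have eB' j : j \in s -> B' j = B j.
  by rewrite /B'; case: eqP => // -> is'; rewrite is' in si.
have -> : D `&` Y i @^-1` b `&` cylinder s B = D `&` cylinder (i :: s) B'.
  rewrite cylinder_cons /B' eqxx setIA; congr (_ `&` _).
  by apply: eq_bigcapr => j js; rewrite -/(B' j) eB'.
rewrite h/= ?si//; last by move=> j; rewrite inE => /predU1P[->//|/sJ[]].
rewrite big_cons {1}/B' eqxx muleA (indep_ofE _ hD Ji); congr (_ * _).
by rewrite big_seq [RHS]big_seq; apply: eq_bigr => j js; rewrite eB'.
Qed.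

Lemma indep_of_partition D J N : measurable D -> nat_measurable N ->
  (forall k, indep_of (D `&` N @^-1` [set k]) J) -> indep_of D J.
Proof.
move=> mD mN h; split=> // s B us sJ.
have mC := measurable_cylinder s B.
rewrite (measure_partition _ (measurableI _ _ mD mC) mN) (measure_partition _ mD mN).
under eq_eseriesr do rewrite setIAC (h _).2//.
have pf : \prod_(i <- s) P (Y i @^-1` B i) \is a fin_num.
  by apply: prode_fin_num => i _; apply: fin_num_measure; exact: nat_measurable_rv.
rewrite -(fineK pf) muleC -nneseriesZl//.
by apply: eq_eseriesr => k _; rewrite muleC.
Qed.

Section partial_sums.
Variable g : nat -> I.
Hypothesis g_inj : injective g.

Definition psum j (w : T) := (\sum_(l < j) Y (g l) w)%N.

Lemma psumS j w : psum j.+1 w = (psum j w + Y (g j) w)%N.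
Proof. by rewrite /psum big_ord_recr. Qed.

Lemma nat_measurable_psum j : nat_measurable (psum j).
Proof.
elim: j => [|j IH].
  rewrite (_ : psum 0 = cst 0%N); last by apply/funext => w; rewrite /psum big_ord0.
  by move=> B; rewrite preimage_cst; case: ifP.
rewrite (_ : psum j.+1 = fun w => (psum j w + Y (g j) w)%N); last first.
  by apply/funext => w; exact: psumS.
by apply: (nat_measurable_op addn) => //; exact: nat_measurable_rv.
Qed.

(** Conditioning on the last term reduces the number of terms. Injectivity of [g]
ensures that each term is still available when it is reached. *)
Lemma indep_of_psum j v D J : indep_of D J -> (forall l, J (g l)) ->
  indep_of (D `&` psum j @^-1` [set v]) (J `\` g @` `I_j).
Proof.
suff H : indep_of D J -> (forall l, (l < j)%N -> J (g l)) ->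
    indep_of (D `&` psum j @^-1` [set v]) (J `\` g @` `I_j).
  by move=> hD gJ; apply: H => // l _; exact: gJ.
elim: j v D J => [|j IH] v D J hD gJ.
  have [->|v0] := eqVneq v 0%N.
    rewrite (_ : _ `&` _ = D); first by apply: indep_ofS hD => i [].
    by apply/seteqP; split => [w []//|w Dw]; split => //=; rewrite /psum big_ord0.
  rewrite (_ : _ `&` _ = set0); first exact: indep_of0.
  apply/seteqP; split => // w [_ /=]; rewrite /psum big_ord0 => v0'.
  by rewrite -v0' eqxx in v0.
have mD := indep_of_measurable hD.
apply: (@indep_of_partition _ _ (Y (g j))).
- by apply: measurableI => //; exact: nat_measurable_psum.
- exact: nat_measurable_rv.
move=> a; have [av|va] := leqP a v; last first.
  rewrite (_ : _ `&` _ = set0); first exact: indep_of0.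
  by apply/seteqP; split => // w [[_ /=]]; rewrite psumS => + ya; rewrite ya; lia.
rewrite (_ : _ `&` _ = D `&` Y (g j) @^-1` [set a] `&` psum j @^-1` [set (v - a)%N]).
  apply: indep_ofS (IH (v - a)%N _ _ (indep_ofI [set a] hD (gJ _ (ltnSn j))) _).
    move=> i [Ji nij]; split.
      by split=> //= ie; apply: nij; exists j => //=.
    by move=> [l /= lj le]; apply: nij; exists l => //=; exact: ltnW.
  move=> l lj; split; first by apply: gJ; exact: ltnW.
  by move=> /g_inj ejl; rewrite ejl ltnn in lj.
apply/seteqP; split => w /=; rewrite psumS; first by case=> [[Dw <-] <-]; rewrite addnK.
by move=> [[Dw ya] ->]; rewrite ya subnK.
Qed.

(** Conditioning on the last term reproduces the recursion of [conv_cdf]. *)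
Lemma measure_psum_le f j n D J : indep_of D J -> (forall l, J (g l)) ->
  (forall l a, P (Y (g l) @^-1` [set a]) = (f a)%:E) ->
  P (D `&` [set w | (psum j w <= n)%N]) = P D * (conv_cdf f j n)%:E.
Proof.
move=> + + hf.
suff H : indep_of D J -> (forall l, (l < j)%N -> J (g l)) ->
    P (D `&` [set w | (psum j w <= n)%N]) = P D * (conv_cdf f j n)%:E.
  by move=> hD gJ; apply: H => // l _; exact: gJ.
elim: j n D J => [|j IH] n D J hD gJ.
  rewrite mule1; congr (P _); apply/seteqP; split => [w []//|w Dw]; split => //=.
  by rewrite /psum big_ord0.
have mD := indep_of_measurable hD.
have mS := nat_measurable_psum j.+1 [set k | (k <= n)%N].
have -> : D `&` [set w | (psum j.+1 w <= n)%N] =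
    (D `&` [set w | (psum j.+1 w <= n)%N]) `&` [set w | (Y (g j) w < n.+1)%N].
  apply/seteqP; split => [w [Dw /= Sw]|w []//]; split => //=.
  by move: Sw; rewrite psumS; lia.
rewrite measure_partition_lt; [|exact: measurableI|exact: nat_measurable_rv].
have -> : (conv_cdf f j.+1 n)%:E = \sum_(i < n.+1) (f i * conv_cdf f j (n - i))%:E.
  by rewrite sumEFin.
rewrite ge0_sume_distrr. 
  apply: eq_bigr => i _.
  rewrite (_ : _ `&` _ = D `&` Y (g j) @^-1` [set (i : nat)] `&`
      [set w | (psum j w <= n - i)%N]).
    rewrite (IH _ _ _ (indep_ofI _ hD (gJ _ (ltnSn j)))).
      by rewrite (indep_ofE _ hD (gJ _ (ltnSn j))) hf EFinM muleA.
    move=> l lj; split; first by apply: gJ; exact: ltnW.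
    by move=> /g_inj ejl; rewrite ejl ltnn in lj.
  have := ltn_ord i; rewrite ltnS => ile.
  apply/seteqP; split => w /=; rewrite psumS.
    by case=> [[Dw Sw] yi]; split => //; move: Sw; rewrite yi; lia.
  by case=> [[Dw yi] Sw]; split => //; split => //; rewrite yi; lia.
move=> i _; rewrite lee_fin mulr_ge0//.
  by rewrite -lee_fin -(hf 0%N).
by apply: conv_cdf_ge0 => k; rewrite -lee_fin -(hf 0%N).
Qed.

End partial_sums.
End independence.

(** * Laws of variables with values in the natural numbers *)

Section laws.
Context {d : measure_display} {T : measurableType d} {R : realType}.
Variable P : probability T R.
Implicit Types (N M : {RV P >-> nat}).

Definition mass (N : T -> nat) (k : nat) : R := fine (P (N @^-1` [set k])).

Lemma massE N k : P (N @^-1` [set k]) = (mass N k)%:E.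
Proof. by apply: measure_fin; exact: nat_measurable_rv. Qed.

Lemma mass_ge0 N k : 0 <= mass N k.
Proof. by rewrite fine_ge0. Qed.

Lemma measure_lt_nat N n : P [set w | (N w < n)%N] = (\sum_(k < n) mass N k)%:E.
Proof.
have := @measure_partition_lt _ _ _ P setT N n measurableT (nat_measurable_rv N).
by rewrite setTI => ->; rewrite -sumEFin; apply: eq_bigr => k _; rewrite setTI massE.
Qed.

Lemma mass_le1 N n : \sum_(k < n) mass N k <= 1.
Proof.
rewrite -lee_fin -measure_lt_nat; apply: probability_le1.
exact: (nat_measurable_rv N [set k | (k < n)%N]).
Qed.

Lemma measure_gt_nat N n :
  P [set w | (n < N w)%N] = (stail (mass N) n%:R)%:E.
Proof.
rewrite stail_nat EFinB -measure_lt_nat.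
have mN : measurable [set w | (N w < n.+1)%N].
  exact: (nat_measurable_rv N [set k | (k < n.+1)%N]).
rewrite -(probability_setC P mN).
congr (P _); apply/seteqP; split => w /= => [nN|/negP]; last by rewrite -leqNgt.
by rewrite ltnS leqNgt nN.
Qed.

Lemma measure_gt_real N x : 0 <= x ->
  P [set w | x < (N w)%:R] = (stail (mass N) x)%:E.
Proof.
move=> x0; rewrite -stail_truncn -measure_gt_nat; congr (P _).
by apply/seteqP; split => w /=; rewrite truncn_lt_nat.
Qed.

Lemma tail_stail N x : 0 <= x -> tail (real_rv N) x = stail (mass N) x.
Proof.
move=> x0; rewrite /tail /ccdf.
rewrite -[RHS]/(fine (stail (mass N) x)%:E) -measure_gt_real//; congr (fine (P _)).
by apply/seteqP; split => w /=; rewrite in_itv/= andbT.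
Qed.

Lemma tail_stail_near N : \forall x \near +oo, tail (real_rv N) x = stail (mass N) x.
Proof.
have := nbhs_pinfty_ge (num_real (0 : R)).
by apply: filterS => x; exact: tail_stail.
Qed.

Lemma stail_mass_to0 N : stail (mass N) x @[x --> +oo] --> 0.
Proof.
have h : fine (ccdf (real_rv N) x) @[x --> +oo] --> (0 : R).
  by apply: fine_cvg; exact: cvg_ccdfy0.
by apply: cvg_trans h; apply: near_eq_cvg; exact: tail_stail_near.
Qed.

Lemma regularly_varying_rv_function N alpha :
  regularly_varying (real_rv N) alpha -> rv_function (stail (mass N)) alpha.
Proof.
case=> _ t0 tq; split=> [x y|x x0|q q0].
- by apply: stail_homo; exact: mass_ge0.
- by rewrite -tail_stail ?ltW// t0.
apply: cvg_trans (tq q q0); apply: near_eq_cvg.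
have h := tail_stail_near N.
by apply: (filterS2 _ _ h (near_pinfty_scale q0 h)) => x -> ->.
Qed.

Lemma rv_function_regularly_varying N alpha :
  rv_function (stail (mass N)) alpha -> regularly_varying (real_rv N) alpha.
Proof.
case=> _ t0 tq; split=> [w|x x0|q q0].
- by rewrite /real_rv /= /real_of_nat_rv ler0n.
- by rewrite tail_stail ?ltW// t0.
apply: cvg_trans (tq q q0); apply: near_eq_cvg.
have h := tail_stail_near N.
by apply: (filterS2 _ _ h (near_pinfty_scale q0 h)) => x -> ->.
Qed.

Local Notation E N := (\int[P]_w (N w)%:R%:E)%E.

Lemma expectationE N : ('E_P[real_rv N] = E N)%E.
Proof. by rewrite unlock. Qed.

Lemma integral_mass N : E N = (\sum_(0 <= k <oo) (k%:R * mass N k)%:E)%E.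
Proof.
rewrite integral_nat_rv//; last exact: nat_measurable_rv.
by apply: eq_eseriesr => k _; rewrite setTI massE EFinM.
Qed.

Lemma integral_mass_lty N B :
  (forall n, \sum_(i < n) i%:R * mass N i <= B) -> (E N < +oo)%E.
Proof.
move=> hB; rewrite integral_mass (@le_lt_trans _ _ B%:E)// ?ltry//.
apply: lime_le.
  by apply: is_cvg_nneseries => n _ _; rewrite lee_fin mulr_ge0// mass_ge0.
by apply: nearW => n; rewrite sumEFin lee_fin big_mkord.
Qed.

Lemma is_mean_mass N : (E N < +oo)%E -> is_mean (mass N) (fine (E N)).
Proof.
move=> Noo; rewrite /is_mean.
have Nfin : E N \is a fin_num.
  by rewrite ge0_fin_numE// integral_ge0// => w _; rewrite lee_fin.
have h : (\sum_(0 <= i < n) (i%:R * mass N i)%:E)%E @[n --> \oo] --> (fine (E N))%:E.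
  rewrite fineK// integral_mass.
  apply: (@is_cvg_nneseries _ (fun k => (k%:R * mass N k)%:E) xpredT 0%N) => n _ _.
  by rewrite lee_fin mulr_ge0// mass_ge0.
apply: cvg_trans (fine_cvg h); apply: near_eq_cvg.
by apply: nearW => n /=; rewrite sumEFin/= big_mkord.
Qed.

Lemma mean_ge0 (N : T -> nat) : (0 <= E N)%E.
Proof. by apply: integral_ge0 => w _; rewrite lee_fin. Qed.

Lemma integral_indep (D : set T) N : measurable D ->
  (forall k, P (D `&` N @^-1` [set k]) = P D * P (N @^-1` [set k]))%E ->
  (\int[P]_(w in D) (N w)%:R%:E = P D * E N)%E.
Proof.
move=> mD h; rewrite !integral_nat_rv//; try exact: nat_measurable_rv.
under eq_eseriesr do rewrite h.
rewrite (measure_fin P mD) -nneseriesZl//; last first.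
  by move=> k _; rewrite mule_ge0// lee_fin.
by apply: eq_eseriesr => k _; rewrite setTI muleCA.
Qed.

Lemma eq_mass N M : identically_distributed N M -> mass N = mass M.
Proof. by move=> h; apply/funext => k; rewrite /mass; congr fine; exact: h. Qed.

Lemma eq_integral_law N M : identically_distributed N M -> E N = E M.
Proof. by move=> h; rewrite !integral_mass (eq_mass h). Qed.

Lemma powerE N r :
  ('E_P[fun w => ((real_rv N) w `^ r)%R] = \int[P]_w ((N w)%:R `^ r)%:E)%E.
Proof. by rewrite unlock. Qed.

Lemma markov_power N r x : 0 < r -> 0 < x ->
  (\int[P]_w ((N w)%:R `^ r)%:E < +oo)%E ->
  stail (mass N) x <= fine (\int[P]_w ((N w)%:R `^ r)%:E) * x `^ (- r).
Proof.
move=> r0 x0; set K := integral _ _ _ => Koo.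
have mNr A : measurable A -> measurable_fun A (fun w => ((N w)%:R `^ r)%:E).
  move=> mA.
  exact: (nat_measurable_fun (fun k => k%:R `^ r) mA (nat_measurable_rv N)).
have K0 : (0 <= K)%E by apply: integral_ge0 => w _; rewrite lee_fin powR_ge0.
have Kf : K \is a fin_num by rewrite ge0_fin_numE.
rewrite powRN ler_pdivlMr ?powR_gt0// -lee_fin fineK// mulrC EFinM.
rewrite -(measure_gt_real _ (ltW x0)).
set A := [set w | x < (N w)%:R].
have mA : measurable A.
  exact: (nat_measurable_rv N [set k | x < k%:R]).
apply: (@le_trans _ _ (\int[P]_(w in A) ((N w)%:R `^ r)%:E)%E); last first.
  by apply: ge0_subset_integral => //; exact: mNr.
rewrite -integral_cst//; apply: ge0_le_integral => //.
- by move=> w _ /=; rewrite lee_fin powR_ge0.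
- exact: mNr.
- move=> w /= xN; rewrite lee_fin; apply: (ge0_ler_powR (ltW r0)).
  + by rewrite nnegrE ltW.
  + by rewrite nnegrE.
  + exact: ltW.
Qed.

Lemma mean_lty_of_power N r : 1 <= r ->
  (\int[P]_w ((N w)%:R `^ r)%:E < +oo)%E -> (E N < +oo)%E.
Proof.
move=> r1; apply: le_lt_trans; apply: ge0_le_integral => //.
- exact: (nat_measurable_fun (fun k => k%:R) measurableT (nat_measurable_rv N)).
- exact: (nat_measurable_fun (fun k => k%:R `^ r) measurableT (nat_measurable_rv N)).
move=> w _; rewrite lee_fin; case: (N w) => [|k]; first exact: powR_ge0.
by rewrite -[leLHS]powRr1// ler_powR// ler1n.
Qed.

End laws.

(** * Random sums of independent variables *)

Section random_sum.
Context {d : measure_display} {T : measurableType d} {R : realType}.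
Variable P : probability T R.
Variables (I : eqType) (Y : I -> {RV P >-> nat}).
Variables (g : nat -> I) (f : nat -> R) (J : set I) (N : {RV P >-> nat}).
Hypothesis g_inj : injective g.
Hypothesis g_law : forall l a, P (Y (g l) @^-1` [set a]) = (f a)%:E.
Hypothesis gJ : forall l, J (g l).
Hypothesis N_indep : forall B, indep_of Y (N @^-1` B) J.

Local Notation S := (psum Y g).

Definition random_sum (w : T) : nat := S (N w) w.

Lemma measure_psum_gt D j n : indep_of Y D J ->
  P (D `&` [set w | (n < S j w)%N]) = (fine (P D) * (1 - conv_cdf f j n))%:E.
Proof.
move=> hD; have mD := indep_of_measurable hD.
have mS := nat_measurable_psum Y g j.
have h := measure_psum_le g_inj j n hD gJ g_law.
have mL : measurable [set w | (S j w <= n)%N] by exact: (mS [set k | (k <= n)%N]).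
have : P D = (P (D `\` [set w | (S j w <= n)%N])
    + P (D `&` [set w | (S j w <= n)%N]))%E by exact: measureDI.
rewrite h.
have -> : D `\` [set w | (S j w <= n)%N] = D `&` [set w | (n < S j w)%N].
  apply/seteqP; split => w /= [Dw nS]; split => //.
    by rewrite ltnNge; apply/negP.
  by apply/negP; rewrite -ltnNge.
have mG : measurable (D `&` [set w | (n < S j w)%N]).
  by apply: measurableI => //; exact: (mS [set k | (n < k)%N]).
rewrite (measure_fin P mD) (measure_fin P mG) -EFinM -EFinD => -[e].
by rewrite mulrBr mulr1 {1}e addrK.
Qed.

Lemma nat_measurable_random_sum : nat_measurable random_sum.
Proof.
move=> B; have -> : random_sum @^-1` B = \bigcup_k (N @^-1` [set k] `&` S k @^-1` B).
  by apply/seteqP; split => [w Bw|w [k _ [/= <-]]//]; exists (N w).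
apply: bigcupT_measurable => k; apply: measurableI; first exact: nat_measurable_rv.
exact: nat_measurable_psum.
Qed.

Lemma leq_psum w : {homo S^~ w : j k / (j <= k)%N >-> (j <= k)%N}.
Proof.
move=> j k jk; rewrite /psum (big_ord_widen _ (fun l => Y (g l) w) jk) big_mkcond/=.
by apply: leq_sum => l _; case: ifP.
Qed.

Let E n := [set w | (n < random_sum w)%N].

Let mE n : measurable (E n).
Proof. exact: (nat_measurable_random_sum [set k | (n < k)%N]). Qed.

Lemma measure_random_sum_lt n M :
  P (E n `&` [set w | (N w < M)%N]) =
  (\sum_(k < M) mass P N k * (1 - conv_cdf f k n))%:E.
Proof.
rewrite measure_partition_lt//; last exact: nat_measurable_rv.
rewrite -sumEFin; apply: eq_bigr => k _; rewrite -measure_psum_gt//.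
congr (P _); apply/seteqP; split => w /= [].
  by rewrite /E /= /random_sum => nS Nk; rewrite Nk in nS.
by move=> Nk nS; split => //; rewrite /E /= /random_sum Nk.
Qed.

(** On {N > M} the random sum is at least the sum of its first [M] terms, which is
independent of N. *)
Lemma random_sum_tail_bounds n M :
  \sum_(k < M.+1) mass P N k * (1 - conv_cdf f k n)
    + stail (mass P N) M%:R * (1 - conv_cdf f M n) <= fine (P (E n)) <=
  \sum_(k < M.+1) mass P N k * (1 - conv_cdf f k n) + stail (mass P N) M%:R.
Proof.
have mN (B : set nat) : measurable (N @^-1` B) by exact: nat_measurable_rv.
have mL : measurable [set w | (N w < M.+1)%N] by exact: (mN [set k | (k < M.+1)%N]).
have mG : measurable [set w | (M < N w)%N] by exact: (mN [set k | (M < k)%N]).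
have mEL : measurable (E n `\` [set w | (N w < M.+1)%N]) by exact: measurableD.
have -> : fine (P (E n)) = \sum_(k < M.+1) mass P N k * (1 - conv_cdf f k n)
    + fine (P (E n `\` [set w | (N w < M.+1)%N])).
  have e : P (E n) = (P (E n `\` [set w | (N w < M.+1)%N])
      + P (E n `&` [set w | (N w < M.+1)%N]))%E by exact: measureDI.
  by rewrite e measure_random_sum_lt fineD ?fin_num_measure// addrC.
rewrite !lerD2l -!lee_fin -(measure_fin P mEL); apply/andP; split; last first.
  rewrite -measure_gt_nat; apply: le_measure; rewrite ?inE//.
  by move=> w [_ /= /negP]; rewrite -leqNgt.
have := measure_psum_gt M n (N_indep [set k | (M < k)%N]).
rewrite [N @^-1` _](_ : _ = [set w | (M < N w)%N])// measure_gt_nat /= => <-.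
apply: le_measure; rewrite ?inE//.
  apply: measurableI => //.
  exact: (nat_measurable_psum Y g M [set k | (n < k)%N]).
move=> w [/= MN nS]; split => /=; last by apply/negP; rewrite -leqNgt.
exact: leq_trans nS (leq_psum w (ltnW MN)).
Qed.

Lemma integral_partition (h : T -> \bar R) : measurable_fun setT h ->
  (forall w, 0 <= h w)%E ->
  (\int[P]_w h w = \sum_(0 <= k <oo) \int[P]_(w in N @^-1` [set k]) h w)%E.
Proof.
move=> mh h0.
have eT : setT = \bigcup_k (N @^-1` [set k]).
  by apply/seteqP; split => // w _; exists (N w).
rewrite [in LHS]eT ge0_integral_bigcup//.
- by move=> k; exact: nat_measurable_rv.
- by rewrite -eT.
- exact: trivIset_preimage1.
Qed.

Lemma integral_random_sum (m : R) : (forall l, \int[P]_w (Y (g l) w)%:R%:E = m%:E)%E ->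
  (\int[P]_w (random_sum w)%:R%:E = m%:E * \int[P]_w (N w)%:R%:E)%E.
Proof.
move=> hm.
have m0 : 0 <= m by rewrite -lee_fin -(hm 0%N); exact: mean_ge0.
rewrite integral_partition; last by move=> w; rewrite lee_fin.
  rewrite integral_mass -nneseriesZl; last first.
    by move=> k _; rewrite lee_fin mulr_ge0// mass_ge0.
  apply: eq_eseriesr => k _.
  have mk : measurable (N @^-1` [set k]) by exact: nat_measurable_rv.
  transitivity (\int[P]_(w in N @^-1` [set k])
      (\sum_(l <- index_enum 'I_k) (Y (g l) w)%:R%:E))%E.
    apply: eq_integral => w; rewrite inE /random_sum /= => ->.
    by rewrite sumEFin /psum natr_sum.
  rewrite ge0_integral_sum//; last first.
    by move=> l; exact: (nat_measurable_fun (fun k => k%:R) mk (nat_measurable_rv _)).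
  transitivity (\sum_(l < k) (mass P N k * m)%:E)%E.
    apply: eq_bigr => l _; rewrite integral_indep//.
      by rewrite hm massE.
    by move=> a; rewrite (indep_ofE _ (N_indep _) (gJ l)).
  by rewrite sumEFin sumr_const card_ord -mulr_natl -EFinM; congr (_%:E); ring.
exact: (nat_measurable_fun (fun k => k%:R) measurableT nat_measurable_random_sum).
Qed.

End random_sum.

(** * Galton--Watson processes with immigration *)

Section galton_watson_immigration.
Context {d : measure_display} {T : measurableType d} {R : realType}.
Variable P : probability T R.
Variables (X : nat -> {RV P >-> nat}) (xi : nat -> nat -> {RV P >-> nat}).
Variable eps : nat -> {RV P >-> nat}.
Hypothesis hX : gw_immigration X xi eps.

Local Notation index := (unit + (nat * nat + nat))%type.
Let Y : index -> {RV P >-> nat} := gwi_family (X 0%N) xi eps.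

(** The time from which an input variable influences the process. *)
Let generation (i : index) : nat :=
  match i with
  | inl _ => 0
  | inr (inl (n, _)) => n.+1
  | inr (inr n) => n.+1
  end.

Let later n : set index := [set i | (n < generation i)%N].
Let offspring n l : index := inr (inl (n, l)).
(** The immigration comes first, so that on {X n = k} the value of X (n + 1) is the sum
of the first k + 1 inputs. *)
Let inputs n l : index := if l is l'.+1 then offspring n l' else inr (inr n).

Let offspring_inj n : injective (offspring n).
Proof. by move=> i j []. Qed.

Let inputs_inj n : injective (inputs n).
Proof. by move=> [|i] [|j] //= []// ->. Qed.

Let later_offspring n l : later n (offspring n l).
Proof. by rewrite /later /=. Qed.

Let S n := random_sum Y (offspring n) (X n).

Let X_S n w : X n.+1 w = (S n w + eps n.+1 w)%N.
Proof.
rewrite (gwi_rec hX)//; congr (_ + _)%N.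
by rewrite /S /random_sum /psum big_add1 big_mkord.
Qed.

Let psum_inputs n k w :
  psum Y (inputs n) k.+1 w = (psum Y (offspring n) k w + eps n.+1 w)%N.
Proof. by rewrite /psum big_ord_recl addnC. Qed.

(** On {X n = j} the event {X (n + 1) = k} concerns a partial sum of the inputs of
generation n + 1; this gives the induction step after summing over [j]. *)
Let indep_X1 n k : indep_of Y (X n @^-1` [set k]) (later n).
Proof.
elim: n k => [|n IH] k.
  rewrite -[_ @^-1` _]setTI.
  have := indep_ofI [set k] (indep_ofT (gwi_indep hX) setT) (I : setT (inl tt : index)).
  by apply: indep_ofS => i ig; split => //= e; rewrite e in ig.
apply: (@indep_of_partition _ _ _ _ _ _ _ _ (X n)).
- exact: nat_measurable_rv.
- exact: nat_measurable_rv.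
move=> j.
have -> : X n.+1 @^-1` [set k] `&` X n @^-1` [set j] =
    X n @^-1` [set j] `&` psum Y (inputs n) j.+1 @^-1` [set k].
  apply/seteqP; split => w /= [e1 e2]; split => //.
    by rewrite psum_inputs -e1 X_S /S /random_sum e2.
  by rewrite X_S /S /random_sum e1 -psum_inputs.
apply: indep_ofS (indep_of_psum (@inputs_inj n) j.+1 k (IH j) _); last first.
  by move=> [|l]; rewrite /later /=.
move=> i ng; split; first exact: ltnW.
by move=> [[|l] _ e]; move: ng; rewrite -e /later /= ltnn.
Qed.

Let indep_X n B : indep_of Y (X n @^-1` B) (later n).
Proof.
apply: (@indep_of_partition _ _ _ _ _ _ _ _ (X n)).
- exact: nat_measurable_rv.
- exact: nat_measurable_rv.
move=> k; have [Bk|nBk] := pselect (B k).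
  rewrite (_ : _ `&` _ = X n @^-1` [set k]); first exact: indep_X1.
  by apply/seteqP; split => [w []//|w /= e]; rewrite /preimage /= e.
rewrite (_ : _ `&` _ = set0); first exact: indep_of0.
by apply/seteqP; split => // w [/= + e]; rewrite e.
Qed.

Local Notation law N := (mass P N).
Local Notation E N := (\int[P]_w (N w)%:R%:E)%E.

Let offspring_law n l a : P (Y (offspring n l) @^-1` [set a]) = (law (xi 1%N 1%N) a)%:E.
Proof.
by rewrite -(eq_mass (gwi_xi_id hX (isT : 1 <= n.+1)%N (isT : 1 <= l.+1)%N)) -massE.
Qed.

Lemma gwi_mean n : (E (xi 1%N 1%N) < +oo)%E ->
  (E (X n.+1) = E (xi 1%N 1%N) * E (X n) + E (eps 1%N))%E.
Proof.
move=> xioo; have mS : nat_measurable (S n) by exact: nat_measurable_random_sum.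
transitivity (\int[P]_w ((S n w)%:R%:E + (eps n.+1 w)%:R%:E))%E.
  by apply: eq_integral => w _; rewrite X_S natrD EFinD.
rewrite ge0_integralD//; last first.
- exact: (nat_measurable_fun (fun k => k%:R) measurableT (nat_measurable_rv _)).
- exact: (nat_measurable_fun (fun k => k%:R) measurableT mS).
congr (_ + _)%E; last exact: eq_integral_law (gwi_eps_id hX _).
have xif : E (xi 1%N 1%N) \is a fin_num by rewrite ge0_fin_numE// mean_ge0.
rewrite -(fineK xif); apply: (integral_random_sum (later_offspring n) (indep_X n)) => l.
by rewrite fineK//; exact: eq_integral_law (gwi_xi_id hX _ _).
Qed.

(** The random sum of the offspring has the required tail, and the immigration is a
light-tailed perturbation of it. *)
Lemma gwi_tail_step n (beta r m a : R) : 0 < beta -> beta < r ->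
  rv_function (stail (law (xi 1%N 1%N))) beta ->
  rv_function (stail (law (X n))) beta ->
  (\int[P]_w ((eps 1%N w)%:R `^ r)%:E < +oo)%E ->
  is_mean (law (xi 1%N 1%N)) m -> 0 < m -> is_mean (law (X n)) a -> 0 < a ->
  asymp_equiv (stail (law (X n.+1)))
    (fun x => a * stail (law (xi 1%N 1%N)) x + m `^ beta * stail (law (X n)) x).
Proof.
move=> beta0 br rF rG epsoo fm m0 pa a0.
pose Q (x : R) := fine (P [set w | (Num.truncn x < S n w)%N]).
have mS : nat_measurable (S n) by exact: nat_measurable_random_sum.
have mSv v : measurable [set w | (v < S n w)%N] by exact: (mS [set k | (v < k)%N]).
have mNv (N : {RV P >-> nat}) v : measurable [set w | (v < N w)%N].
  exact: (nat_measurable_rv N [set k | (v < k)%N]).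
have stailE (N : {RV P >-> nat}) x :
    stail (law N) x = fine (P [set w | (Num.truncn x < N w)%N]).
  by rewrite measure_gt_nat stail_truncn.
have bnd M (x : R) := random_sum_tail_bounds (@offspring_inj n) (offspring_law n)
  (later_offspring n) (indep_X n) (Num.truncn x) M.
have QH : asymp_equiv Q
    (fun x => a * stail (law (xi 1%N 1%N)) x + m `^ beta * stail (law (X n)) x).
  apply: random_sum_tail => //; try exact: mass_ge0; try exact: mass_le1.
  - exact: ltW.
  - exact: stail_mass_to0.
  - by move=> M x _; have /andP[] := bnd M x.
  - by move=> M x _; have /andP[] := bnd M x.
apply: (asymp_equiv_light_perturbation (E := stail (law (eps n.+1)))
  (K := fine (\int[P]_w ((eps 1%N w)%:R `^ r)%:E)%E) _ (ltW beta0) br QH).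
- by apply: rv_function_lin => //; exact: powR_gt0.
- move=> x x0; rewrite (eq_mass (gwi_eps_id hX (isT : 1 <= n.+1)%N)).
  by apply: markov_power => //; exact: lt_trans br.
- move=> x x0; rewrite stailE /Q fine_le ?fin_num_measure//.
  apply: le_measure; rewrite ?inE// => w /= h.
  by rewrite X_S ltn_addr.
move=> q x /andP[q0 q1] x0; rewrite !stailE /Q -fineD ?fin_num_measure//.
rewrite fine_le ?fin_num_measure ?fin_numD ?fin_num_measure//.
apply: (@le_trans _ _ (P ([set w | (Num.truncn (q * x) < S n w)%N] `|`
    [set w | (Num.truncn ((1 - q) * x) < eps n.+1 w)%N]))); last exact: measureU2.
apply: le_measure; rewrite ?inE//; first exact: measurableU.
move=> w /=; rewrite X_S => h.
have [|h1] := ltnP (Num.truncn (q * x)) (S n w); [by left|right].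
rewrite ltnNge; apply/negP => h2; move: h; rewrite ltnNge => /negP; apply.
apply: leq_trans (leq_add h1 h2) _; rewrite truncn_ge_nat// natrD.
have q'0 : 0 <= 1 - q by rewrite subr_ge0 ltW.
have /andP[t1 _] := truncn_itv (mulr_ge0 (ltW q0) x0).
have /andP[t2 _] := truncn_itv (mulr_ge0 q'0 x0).
by apply: (le_trans (lerD t1 t2)); rewrite -mulrDl addrC subrK mul1r.
Qed.

End galton_watson_immigration.

Section coefficients.
Context {R : realType}.
Variables (beta a0 m me : R).
Hypothesis m_gt0 : 0 < m.

(** The coefficient of P (xi > x) in the tail of X_n, for a process with E X_0 = [a0],
offspring mean [m] and immigration mean [me]. *)
Definition gwi_xi_coef (n : nat) : R :=
  a0 * m ^+ (n - 1) * (\sum_(0 <= i < n) m `^ (i%:R * (beta - 1)))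
  + me * (\sum_(1 <= i < n) (m ^+ (n - i - 1)
                * \sum_(0 <= j < n - i) m `^ (j%:R * (beta - 1)))).

(** The mean of X_n. *)
Definition gwi_mean_coef (n : nat) : R := m ^+ n * a0 + me * \sum_(j < n) m ^+ j.

Let th := m `^ (beta - 1).

Let geoE n : \sum_(0 <= i < n) m `^ (i%:R * (beta - 1)) = \sum_(i < n) th ^+ i.
Proof.
rewrite big_mkord; apply: eq_bigr => i _.
by rewrite mulrC powRrM powR_mulrn// powR_ge0.
Qed.

Let mth : m `^ beta = m * th.
Proof.
rewrite /th -[X in X * _](powRr1 (ltW m_gt0)) -powRD ?(gt_eqF m_gt0) ?implybT//.
by rewrite addrC subrK.
Qed.

Let geoS n : \sum_(i < n.+1) th ^+ i = 1 + th * \sum_(i < n) th ^+ i.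
Proof.
rewrite big_ord_recl expr0 mulr_sumr; congr (_ + _).
by apply: eq_bigr => i _; rewrite exprS.
Qed.

Lemma gwi_xi_coef0 : gwi_xi_coef 0 = 0.
Proof. by rewrite /gwi_xi_coef !big_geq// !mulr0 addr0. Qed.

Lemma gwi_xi_coefS n :
  gwi_xi_coef n.+1 = gwi_mean_coef n + m `^ beta * gwi_xi_coef n.
Proof.
case: n => [|n].
  rewrite gwi_xi_coef0 /gwi_xi_coef /gwi_mean_coef geoE big_ord1 big_geq// big_ord0.
  by rewrite subnn !expr0 !mulr1 !mulr0 mul1r !addr0.
rewrite /gwi_xi_coef /gwi_mean_coef !geoE mth !subn1/= geoS.
have -> : \sum_(1 <= i < n.+2) m ^+ (n.+2 - i - 1) *
      (\sum_(0 <= j < n.+2 - i) m `^ (j%:R * (beta - 1))) =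
    \sum_(j < n.+1) m ^+ j + m * th * \sum_(1 <= i < n.+1) m ^+ (n.+1 - i - 1) *
      (\sum_(0 <= j < n.+1 - i) m `^ (j%:R * (beta - 1))).
  have -> : \sum_(j < n.+1) m ^+ j = \sum_(1 <= i < n.+2) m ^+ (n.+2 - i - 1).
    (* reversal of the order of summation *)
    rewrite -(big_mkord xpredT (fun j => m ^+ j)) big_nat_rev/= add0n big_add1/=.
    by apply: eq_big_nat => i /andP[_ ?]; congr (_ ^+ _); lia.
  rewrite mulr_sumr [X in _ = _ + X](_ : _ =
      \sum_(1 <= i < n.+2) m ^+ (n.+2 - i - 1) * (th * \sum_(j < n.+1 - i) th ^+ j)).
    rewrite -big_split/=; apply: eq_big_nat => i /andP[i1 i2].
    by rewrite geoE [(n.+2 - i)%N](_ : _ = (n.+1 - i).+1); [rewrite geoS; ring|lia].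
  rewrite [RHS]big_nat_recr//= subnn big_ord0 !mulr0 addr0.
  apply: eq_big_nat => i /andP[i1 i2].
  rewrite geoE [(n.+2 - i - 1)%N](_ : _ = (n.+1 - i - 1).+1); last by lia.
  by rewrite exprS; ring.
rewrite [m ^+ n.+1]exprS; ring.
Qed.

Lemma gwi_mean_coefS n : gwi_mean_coef n.+1 = m * gwi_mean_coef n + me.
Proof.
rewrite /gwi_mean_coef big_ord_recl expr0 exprS.
under eq_bigr do rewrite /= exprS.
by rewrite -mulr_sumr; ring.
Qed.

End coefficients.

Theorem proposition2p3 (d : measure_display) (T : measurableType d)
    (R : realType) (P : probability T R)
    (X : nat -> {RV P >-> nat}) (xi : nat -> nat -> {RV P >-> nat})
    (eps : nat -> {RV P >-> nat}) (beta : R)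
    (hX : gw_immigration X xi eps)
    (hbeta : 1 <= beta)
    (hX0 : regularly_varying (real_rv (X 0%N)) beta)
    (hxi : regularly_varying (real_rv (xi 1%N 1%N)) beta)
    (hO : asymp_bigO (tail (real_rv (xi 1%N 1%N))) (tail (real_rv (X 0%N))))
    (heps : exists2 r : R, beta < r &
      ('E_P[fun w => (real_rv (eps 1%N) w `^ r)%R] < +oo)%E)
    (hbeta1 : beta = 1 ->
      ((0 < 'E_P[real_rv (X 0%N)] < +oo) &&
       (0 < 'E_P[real_rv (xi 1%N 1%N)] < +oo))%E) :
  let EX0 : R := fine 'E_P[real_rv (X 0%N)] in
  let m_xi : R := fine 'E_P[real_rv (xi 1%N 1%N)] in
  let m_eps : R := fine 'E_P[real_rv (eps 1%N)] in
  forall n : nat, (1 <= n)%N ->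
    asymp_equiv (tail (real_rv (X n)))
      (fun x : R =>
         EX0 * m_xi ^+ (n - 1)
           * (\sum_(0 <= i < n) m_xi `^ (i%:R * (beta - 1)))
           * tail (real_rv (xi 1%N 1%N)) x
         + m_xi `^ (n%:R * beta) * tail (real_rv (X 0%N)) x
         + m_eps
           * (\sum_(1 <= i < n) (m_xi ^+ (n - i - 1)
                * \sum_(0 <= j < n - i) m_xi `^ (j%:R * (beta - 1))))
           * tail (real_rv (xi 1%N 1%N)) x)
    /\ regularly_varying (real_rv (X n)) beta.
Proof.
move=> EX0 m_xi m_eps n _.
have beta0 : 0 < beta := lt_le_trans ltr01 hbeta.
have [r br] := heps; rewrite powerE => epsr.
have finite_mean (N : {RV P >-> nat}) : rv_function (stail (mass P N)) beta ->
    (beta = 1 -> ('E_P[real_rv N] < +oo)%E) -> (\int[P]_w (N w)%:R%:E < +oo)%E.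
  move=> rN; have [->|b1] := eqVneq beta 1.
    by move=> /(_ erefl); rewrite expectationE.
  have b1' : 1 < beta by rewrite lt_neqAle eq_sym b1.
  have [B hB] := rv_finite_mean (mass_ge0 N) (mass_le1 N) rN b1'.
  by move=> _; exact: integral_mass_lty hB.
have rF := regularly_varying_rv_function hxi.
have rG := regularly_varying_rv_function hX0.
have X0oo : (\int[P]_w (X 0%N w)%:R%:E < +oo)%E.
  by apply: finite_mean => // /hbeta1 /andP[/andP[]].
have xioo : (\int[P]_w (xi 1%N 1%N w)%:R%:E < +oo)%E.
  by apply: finite_mean => // /hbeta1 /andP[_ /andP[]].
have r1 : 1 <= r := le_trans hbeta (ltW br).
have epsoo := mean_lty_of_power r1 epsr.
rewrite !expectationE in EX0 m_xi m_eps *.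
have fine_mean (N : {RV P >-> nat}) : (\int[P]_w (N w)%:R%:E < +oo)%E ->
    ((fine (\int[P]_w (N w)%:R%:E))%:E = \int[P]_w (N w)%:R%:E)%E.
  by move=> Noo; rewrite fineK// ge0_fin_numE// mean_ge0.
have m_xiE := fine_mean _ xioo; have m_epsE := fine_mean _ epsoo.
rewrite -/m_xi in m_xiE; rewrite -/m_eps in m_epsE.
have mean_pos (N : {RV P >-> nat}) a :
    rv_function (stail (mass P N)) beta -> is_mean (mass P N) a -> 0 < a.
  move=> rN Na; apply: is_mean_gt0 (stail_mass_to0 N) Na _; try exact: mass_ge0.
  have [dN N0 _] := rN; apply: (lt_le_trans (N0 1 ltr01)).
  by apply: dN.
have m_mean : is_mean (mass P (xi 1%N 1%N)) m_xi by exact: is_mean_mass.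
have m0 : 0 < m_xi := mean_pos _ _ rF m_mean.
pose c := gwi_xi_coef beta EX0 m_xi m_eps.
pose a := gwi_mean_coef EX0 m_xi m_eps.
pose F := stail (mass P (xi 1%N 1%N)); pose G := stail (mass P (X 0%N)).
have [rn [_ [_ eqn]]] : rv_function (stail (mass P (X n))) beta /\
    (\int[P]_w (X n w)%:R%:E = (a n)%:E)%E /\ 0 <= c n /\
    asymp_equiv (stail (mass P (X n)))
      (fun x => c n * F x + m_xi `^ (n%:R * beta) * G x).
  elim: n => [|n [rn [En [cn IH]]]].
    split=> //; split.
      rewrite /a /gwi_mean_coef big_ord0 expr0 mul1r mulr0 addr0.
      by rewrite fine_mean.
    rewrite /c gwi_xi_coef0; split => //.
    under [X in asymp_equiv _ X]funext do rewrite mul0r add0r mul0r powRr0 mul1r.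
    exact: asymp_equiv_refl (rv_near_gt0 rG).
  have an : is_mean (mass P (X n)) (a n).
    by rewrite -[a n]/(fine (a n)%:E) -En; apply: is_mean_mass; rewrite En ltry.
  have an0 := mean_pos _ _ rn an.
  have step := gwi_tail_step hX beta0 br rF rn epsr m_mean m0 an an0.
  have mb0 : 0 < m_xi `^ beta by exact: powR_gt0.
  split.
    exact: rv_asymp_closed (stail_homo (mass_ge0 _))
      (rv_function_lin an0 mb0 rF rn) step.
  split.
    by rewrite (gwi_mean hX _ xioo) En -m_xiE -m_epsE -EFinM -EFinD /a gwi_mean_coefS.
  have cS : c n.+1 = a n + m_xi `^ beta * c n by exact: gwi_xi_coefS.
  split; first by rewrite cS; exact: addr_ge0 (ltW an0) (mulr_ge0 (ltW mb0) cn).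
  have F0 := rv_near_gt0 rF; have G0 := rv_near_gt0 rG.
  apply: asymp_equiv_trans step _.
    apply: (filterS2 _ _ F0 (rv_near_gt0 rn)) => x Fx Xx.
    by rewrite addr_gt0// mulr_gt0.
  have -> : (fun x => c n.+1 * F x + m_xi `^ (n.+1%:R * beta) * G x) =
      (fun x => a n * F x + m_xi `^ beta * (c n * F x + m_xi `^ (n%:R * beta) * G x)).
    have e : n.+1%:R * beta = n%:R * beta + beta by rewrite -(natr1 n) mulrDl mul1r.
    by apply/funext => x; rewrite cS e powRD ?(gt_eqF m0) ?implybT//; ring.
  have H0 : \forall x \near +oo, 0 < c n * F x + m_xi `^ (n%:R * beta) * G x.
    apply: (filterS2 _ _ F0 G0) => x Fx Gx.
    by rewrite ltr_wpDl ?mulr_ge0 ?(ltW Fx)// mulr_gt0// powR_gt0.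
  have aF0 : \forall x \near +oo, 0 < a n * F x.
    by apply: filterS F0 => x Fx; exact: mulr_gt0.
  apply: asymp_equivD => //.
  - by apply: filterS H0 => x Hx; exact: mulr_gt0.
  - exact: asymp_equiv_refl.
  - by apply: asymp_equivM2l => //; rewrite gt_eqF.
split; last exact: rv_function_regularly_varying.
apply: cvg_trans eqn; apply: near_eq_cvg.
apply: (filterS3 _ _ (tail_stail_near (X n)) (tail_stail_near (X 0%N))
  (tail_stail_near (xi 1%N 1%N))).
by move=> x -> -> ->; congr (_ / _); rewrite /c /gwi_xi_coef /F /G; ring.
Qed.
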